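(* Suppose that for all $0\le j<k\le n$ there is a constant $c_{j,k}$ such that for all $f\in B(E_k)$ $$\max\big(\|1\|_j\,\|q_{j,k}(f)^2\|_j,\ \|q_{j,k}(f)\|_j^2,\ \|q_{j,k}(f^2)\|_j\big)\le c_{j,k}\,\|f\|_k^2 .$$ Define, for $0\le k\le n$, $$\widehat c_k=\sum_{j=0}^{k-1}c_{j,k}\big(2+\|q_{j,j+1}(1)-1\|_j\big),\qquad \widehat v_k=\sup\Big\{\sum_{j=0}^k \mathrm{Var}_{\mu_j}(q_{j,k}(f))\ \Big|\ f\in B(E_k),\ \|f\|_k\le 1\Big\},$$ $$\varepsilon_k^N=\sup\big\{\mathbb{E}[|\nu_k^N(f)-\mu_k(f)|^2]\ \big|\ f\in B(E_k),\ \|f\|_k\le 1\big\},$$ and $\overline c_k=\max_{j\le k}\widehat c_j$, $\overline v_k=\max_{j\le k}\widehat v_j$, $\overline\varepsilon_k^N=\max_{j\le k}\varepsilon_j^N$. Then for every $f\in B(E_n)$, $$N\,\mathbb{E}[|\nu_n^N(f)-\mu_n(f)|^2]\le \sum_{j=0}^n \mathrm{Var}_{\mu_j}(q_{j,n}(f))+\|f\|_n^2\,\widehat c_n\,\overline\varepsilon_n^N .$$ Moreover, if $N\ge 2\overline c_n$, then $$\overline\varepsilon_n^N\le 2\,\frac{\overline v_n}{N}.$$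
   Context: Setting. $E_0,\dots,E_n$ are Polish spaces; $B(E_k)$ is the space of bounded measurable real functions on $E_k$. For a measure $\mu$ and a function $f$, $\mu(f)=\int f\,d\mu$ and $\mathrm{Var}_\mu(f)=\mu(f^2)-\mu(f)^2$. For a kernel $K$, $K(f)(x)=\int f(z)K(x,dz)$. $\mu_k$ is a probability measure on $E_k$ ($0\le k\le n$). For $1\le k\le n$, $g_{k-1,k}\in B(E_{k-1})$ is a positive function and $K_k$ is a Markov transition kernel from $E_{k-1}$ to $E_k$, such that $\mu_k(f)=\mu_{k-1}(g_{k-1,k}K_k(f))/\mu_{k-1}(g_{k-1,k})$ for all $f\in B(E_k)$. Feynman-Kac propagator: $q_{k-1,k}(f)=g_{k-1,k}K_k(f)/\mu_{k-1}(g_{k-1,k})$ for $f\in B(E_k)$, $q_{j,k}=q_{j,j+1}\circ q_{j+1,j+2}\circ\cdots\circ q_{k-1,k}$ for $j<k$ (mapping $B(E_k)$ to $B(E_j)$), and $q_{k,k}(f)=f$. Particle system with $N\geq 1$ particles: $\xi_0^1,\dots,\xi_0^N$ are i.i.d. from $\mu_0$. For $k=1,\dots,n$: given the past up to $\xi_{k-1}$, the variables $\hat\xi_k^1,\dots,\hat\xi_k^N$ are conditionally i.i.d. with law $\sum_{i=1}^N \frac{g_{k-1,k}(\xi_{k-1}^i)}{\sum_{l=1}^N g_{k-1,k}(\xi_{k-1}^l)}\delta_{\xi_{k-1}^i}$; given the past up to $\hat\xi_k$, the variables $\xi_k^1,\dots,\xi_k^N$ are conditionally independent with $\xi_k^j\sim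 K_k(\hat\xi_k^j,\cdot)$. $\mathbb{E}$ is expectation with respect to the particle system. Empirical measure: $\eta_k^N=\frac1N\sum_{i=1}^N\delta_{\xi_k^i}$. Weighted empirical measure: $\nu_k^N(f)=\varphi_k\,\eta_k^N(f)$ with $\varphi_0=1$ and $\varphi_k=\prod_{j=0}^{k-1}\eta_j^N(q_{j,j+1}(1))$ for $k\ge1$. For $0\le j\le n$, $\|\cdot\|_j$ is a norm on $B(E_j)$ (finite on all of $B(E_j)$). Suprema take values in $[0,\infty]$, with $0\cdot\infty=0$. *)

(* Defs.v *)
From HB Require Import structures.
From mathcomp Require Import all_boot all_order all_algebra.
From mathcomp Require Import all_classical all_reals all_analysis.

Set Implicit Arguments.
Unset Strict Implicit.
Unset Printing Implicit Defensive.

Import Order.TTheory GRing.Theory Num.Theory.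

Local Open Scope classical_set_scope.
Local Open Scope ring_scope.

Notation borel T := (g_sigma_algebraType (@open T)).

Definition is_metric (R : realType) (T : Type) (d : T -> T -> R) : Prop :=
  [/\ forall x y, 0 <= d x y,
      forall x y, d x y = 0 <-> x = y,
      forall x y, d x y = d y x &
      forall x y z, d x z <= d x y + d y z].

Definition polish (R : realType) (T : topologicalType) : Prop :=
  (exists2 D : set T, countable D & dense D) /\
  exists d : T -> T -> R,
    [/\ is_metric d,
        forall (x : T) (U : set T),
          nbhs x U <-> exists2 e : R, 0 < e & [set y | d x y < e] `<=` U &
        forall u : nat -> T,
          (forall e : R, 0 < e ->
             exists m0 : nat, forall p q : nat,
               (m0 <= p)%N -> (m0 <= q)%N -> d (u p) (u q) < e) ->
          exists l : T, u @ \oo --> l].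

Section bounded_measurable.
Context (R : realType) (dsp : measure_display) (T : measurableType dsp).

Definition bounded_measurable (f : T -> R) : Prop :=
  measurable_fun [set: T] f /\ exists M : R, forall x, `|f x| <= M.

(* [nrm] is total on [T -> R]; its values outside bounded measurable functions
   are unconstrained and never used. *)
Definition is_norm (nrm : (T -> R) -> R) : Prop :=
  [/\ forall f, bounded_measurable f -> 0 <= nrm f,
      forall f, bounded_measurable f -> nrm f = 0 -> f = cst 0,
      forall (a : R) f, bounded_measurable f ->
        nrm (fun x => a * f x) = `|a| * nrm f &
      forall f h, bounded_measurable f -> bounded_measurable h ->
        nrm (fun x => f x + h x) <= nrm f + nrm h].

Definition Var (mu : probability T R) (f : T -> R) : R :=
  (\int[mu]_x (f x ^+ 2)) - (\int[mu]_x f x) ^+ 2.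

End bounded_measurable.

Section feynman_kac.
Context (R : realType) (E : nat -> ptopologicalType).
Context (mu : forall k, probability (borel (E k)) R).
(* [g k] is g_{k,k+1} and [K k] is K_{k+1}, the kernel from E_k to E_{k+1}. *)
Context (g : forall k, borel (E k) -> R).
Context (K : forall k, R.-pker (borel (E k)) ~> (borel (E k.+1))).

(* q_{k,k+1} *)
Definition qstep (k : nat) (f : borel (E k.+1) -> R) : borel (E k) -> R :=
  fun x => g x * (\int[K k x]_y f y) / (\int[mu k]_x g x).

(* [qprop f j] is q_{j,k}(f) for f on E_k and j <= k, by recursion on k:
   q_{k,k}(f) = f and q_{j,k+1}(f) = q_{j,k}(q_{k,k+1}(f)).  The value for j > k
   is a dummy. *)
Fixpoint qprop (k : nat) : (borel (E k) -> R) -> forall j, borel (E j) -> R :=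
  match k with
  | 0 => fun f j =>
      if @eqP _ 0 j is ReflectT e then ecast i (borel (E i) -> R) e f else cst 0
  | k'.+1 => fun f j =>
      if @eqP _ k'.+1 j is ReflectT e then ecast i (borel (E i) -> R) e f
      else @qprop k' (qstep f) j
  end.

Arguments qprop : clear implicits.
Arguments qprop {k} f j _.

Lemma qprop_id (k : nat) (f : borel (E k) -> R) : qprop f k = f.
Proof.
by case: k f => [|k] f /=; case: eqP => // e; rewrite (eq_irrelevance e erefl).
Qed.

Lemma qpropS (j k : nat) (f : borel (E k.+1) -> R) :
  (j <= k)%N -> qprop f j = qprop (qstep f) j.
Proof. by move=> jk /=; case: eqP => // e; exfalso; rewrite -e ltnn in jk. Qed.

Section particles.
Context (dO : measure_display) (Omega : measurableType dO).
Context (P : probability Omega R) (N : nat).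
Context (xi : forall k, 'I_N -> Omega -> borel (E k)).
(* The selected particle \hat\xi_{k+1}^i lives in E_k: it is [xihat k i]. *)
Context (xihat : forall k, 'I_N -> Omega -> borel (E k)).

(* Generators of the sigma-algebra of xi_0, ..., xi_{m-1} and
   \hat\xi_1, ..., \hat\xi_{m'}. *)
Definition past (m m' : nat) : set (set Omega) :=
  [set A | (exists j (i : 'I_N) (B : set (borel (E j))),
              [/\ (j < m)%N, measurable B & A = xi j i @^-1` B]) \/
           (exists j (i : 'I_N) (B : set (borel (E j))),
              [/\ (j < m')%N, measurable B & A = xihat j i @^-1` B])].

(* Conditionally on the sigma-algebra generated by G, the variables X_i are
   independent and X_i has the (random) law m_i. *)
Definition cond_indep_law (dT : measure_display) (T : measurableType dT)
    (G : set (set Omega)) (X : 'I_N -> Omega -> T)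
    (m : 'I_N -> Omega -> set T -> \bar R) : Prop :=
  forall A, <<s G >> A ->
  forall B : 'I_N -> set T, (forall i, measurable (B i)) ->
    P (A `&` [set w | forall i, B i (X i w)]) =
    (\int[P]_(w in A) \prod_(i < N) m i w (B i))%E.

Definition selection_law (k : nat) (w : Omega) (B : set (borel (E k))) : \bar R :=
  (\sum_(i < N)
     (g (xi k i w) / \sum_(l < N) g (xi k l w))%:E * \d_(xi k i w) B)%E.

Definition particle_system (n : nat) : Prop :=
  [/\ (forall k i, (k <= n)%N -> measurable_fun [set: Omega] (xi k i)) /\
      (forall k i, (k < n)%N -> measurable_fun [set: Omega] (xihat k i)),
      forall B : 'I_N -> set (borel (E 0)), (forall i, measurable (B i)) ->
        P [set w | forall i, B i (xi 0 i w)] = (\prod_(i < N) mu 0 (B i))%E,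
      forall k, (k < n)%N ->
        cond_indep_law (past k.+1 k) (xihat k) (fun _ w => selection_law w) &
      forall k, (k < n)%N ->
        cond_indep_law (past k.+1 k.+1) (xi k.+1)
          (fun i w => K k (xihat k i w))].

Definition eta (k : nat) (w : Omega) (f : borel (E k) -> R) : R :=
  N%:R^-1 * \sum_(i < N) f (xi k i w).

Definition phi (k : nat) (w : Omega) : R :=
  \prod_(j < k) eta w (qstep (fun _ : borel (E j.+1) => 1)).

Definition nu (k : nat) (w : Omega) (f : borel (E k) -> R) : R :=
  phi k w * eta w f.

Definition mse (k : nat) (f : borel (E k) -> R) : \bar R :=
  ('E_P[fun w => (`|nu w f - \int[mu k]_x f x| ^+ 2)%R])%E.

Context (nrm : forall k, (borel (E k) -> R) -> R).

Definition eps (k : nat) : \bar R :=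
  ereal_sup [set mse f | f in
    [set f : borel (E k) -> R | bounded_measurable f /\ nrm f <= 1]].

Definition epsbar (k : nat) : \bar R :=
  \big[Order.max/-oo%E]_(j < k.+1) eps j.

End particles.

Context (nrm : forall k, (borel (E k) -> R) -> R).

Definition chat (c : nat -> nat -> R) (k : nat) : R :=
  \sum_(j < k) c j k *
    (2 + nrm (fun x => qstep (fun _ : borel (E j.+1) => 1) x - 1)).

(* The initial value chat c 0 is an empty sum and belongs to the maximum. *)
Definition cbar (c : nat -> nat -> R) (k : nat) : R :=
  \big[Num.max/chat c 0]_(j < k.+1) chat c j.

Definition sumVar (k : nat) (f : borel (E k) -> R) : R :=
  \sum_(j < k.+1) Var (mu j) (qprop f j).

Definition vhat (k : nat) : \bar R :=
  ereal_sup [set (sumVar f)%:E | f in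
    [set f : borel (E k) -> R | bounded_measurable f /\ nrm f <= 1]].

Definition vbar (k : nat) : \bar R :=
  \big[Order.max/-oo%E]_(j < k.+1) vhat j.

End feynman_kac.

Arguments qprop {R E} mu g K {k} f j _.

(* Main.v *)
From HB Require Import structures.
Require Import Defs.
From mathcomp Require Import all_boot all_order all_algebra.
From mathcomp Require Import all_classical all_reals all_analysis.
From mathcomp Require Import measurable_realfun ring lra.

Set Implicit Arguments.
Unset Strict Implicit.
Unset Printing Implicit Defensive.

Import Order.TTheory GRing.Theory Num.Theory.

Local Open Scope classical_set_scope.
Local Open Scope ring_scope.

(* For h_j = q_{j,k}(f), the process nu_j(h_j) is a martingale: conditionally on
   the past of xi_j the particles xi_{j+1}^i are i.i.d., and their common law
   integrates h to eta_j(q_{j,j+1}(h)) / eta_j(q_{j,j+1}(1)).  Resolving the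
   second moments of nu_j(h_j) one generation at a time gives
     N E[(nu_k(f) - mu_k(f))^2] = sum_{j <= k} E[phi_j nu_j(h_j^2)]
                                  - sum_{j < k} E[nu_j(h_j)^2] - mu_k(f)^2.
   As E[nu_j(h)] = mu_j(h), this is the sum of the variances up to covariances
   of pairs nu_j(A), nu_j(B) with j < k, each bounded by |A|_j |B|_j eps_j; in the
   term j = k the weight phi_k is first expanded along its increments
   phi_{j+1} - phi_j = nu_j(q_{j,j+1}(1) - 1).  Only the eps_j with j < k enter,
   so by induction every eps_k is finite when the vhat_k are, and the second
   bound follows by absorbing epsbar into the left-hand side. *)

(** * Closure properties of bounded measurable functions *)

Section bounded_measurable_closure.
Context (R : realType) (d : measure_display) (T : measurableType d).
Implicit Types f h : T -> R.

Lemma bounded_measurable_cst (a : R) : bounded_measurable (fun _ : T => a).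
Proof. by split=> //; exists `|a|. Qed.

Lemma bounded_measurableD f h : bounded_measurable f -> bounded_measurable h ->
  bounded_measurable (fun x => f x + h x).
Proof.
move=> [mf [a fa]] [mh [b hb]]; split; first exact: measurable_funD.
by exists (a + b) => x; rewrite (le_trans (ler_normD _ _))// lerD.
Qed.

Lemma bounded_measurableM f h : bounded_measurable f -> bounded_measurable h ->
  bounded_measurable (fun x => f x * h x).
Proof.
move=> [mf [a fa]] [mh [b hb]]; split; first exact: measurable_funM.
by exists (a * b) => x; rewrite normrM ler_pM.
Qed.

Lemma bounded_measurableZ (a : R) f : bounded_measurable f ->
  bounded_measurable (fun x => a * f x).
Proof. by apply: bounded_measurableM; exact: bounded_measurable_cst. Qed.

Lemma bounded_measurableB f h : bounded_measurable f -> bounded_measurable h ->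
  bounded_measurable (fun x => f x - h x).
Proof.
move=> bf /(bounded_measurableZ (-1)) bh.
rewrite (_ : (fun _ => _) = fun x => f x + -1 * h x); last first.
  by apply/funext => x; rewrite mulN1r.
exact: bounded_measurableD.
Qed.

Lemma bounded_measurableX f m : bounded_measurable f ->
  bounded_measurable (fun x => f x ^+ m).
Proof.
move=> [mf [a fa]]; split; first exact: measurable_funX.
by exists (a ^+ m) => x; rewrite normrX lerXn2r// nnegrE// (le_trans _ (fa x)).
Qed.

Lemma bounded_measurable_indic (A : set T) : measurable A ->
  bounded_measurable (\1_A : T -> R).
Proof.
move=> mA; split; first exact: measurable_indic.
by exists 1 => x; rewrite indicE; case: (x \in A); rewrite ?normr1 ?normr0.
Qed.

Lemma bounded_measurable_sum (I : Type) (s : seq I) (f : I -> T -> R) :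
  (forall i, bounded_measurable (f i)) ->
  bounded_measurable (fun x => \sum_(i <- s) f i x).
Proof.
move=> bf; elim: s => [|i s IH].
  under eq_fun do rewrite big_nil; exact: bounded_measurable_cst.
under eq_fun do rewrite big_cons; exact: bounded_measurableD.
Qed.

Lemma bounded_measurable_prod (I : Type) (s : seq I) (Q : pred I)
    (f : I -> T -> R) :
  (forall i, Q i -> bounded_measurable (f i)) ->
  bounded_measurable (fun x => \prod_(i <- s | Q i) f i x).
Proof.
move=> bf; elim: s => [|i s IH].
  under eq_fun do rewrite big_nil; exact: bounded_measurable_cst.
under eq_fun do rewrite big_cons.
by have := bf i; case: (Q i) => // bfi; apply: bounded_measurableM => //; exact: bfi.
Qed.

Lemma bounded_measurable_ge0 f : bounded_measurable f ->
  exists2 M, 0 <= M & forall x, `|f x| <= M.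
Proof.
move=> [_ [M fM]]; exists `|M| => // x.
by rewrite (le_trans (fM x))// ler_norm.
Qed.

End bounded_measurable_closure.

Lemma bounded_measurable_comp (R : realType) (d d' : measure_display)
    (T : measurableType d) (T' : measurableType d') (X : T' -> T) (f : T -> R) :
  measurable_fun [set: T'] X -> bounded_measurable f ->
  bounded_measurable (fun w => f (X w)).
Proof.
move=> mX [mf [a fa]]; split; last by exists a.
exact: (measurableT_comp mf mX).
Qed.

(** * Means of bounded functions under a probability measure *)

Section probability_integral.
Context (R : realType) (d : measure_display) (T : measurableType d).
Context (P : probability T R).
Implicit Types f h : T -> R.

Lemma bounded_measurable_integrable f : bounded_measurable f ->
  P.-integrable [set: T] (EFin \o f).
Proof.
move=> [mf [M fM]]; apply: measurable_bounded_integrable => //.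
  by apply: le_lt_trans (probability_le1 P measurableT) (ltry _).
exists M; split; first exact: num_real.
by move=> r Mr x _; apply: le_trans (fM x) (ltW Mr).
Qed.

Lemma mean_cst (a : R) : \int[P]_x a = a.
Proof. by rewrite Rintegral_cst//= probability_setT/= mulr1. Qed.

Lemma meanD f h : bounded_measurable f -> bounded_measurable h ->
  \int[P]_x (f x + h x) = \int[P]_x f x + \int[P]_x h x.
Proof. by move=> ? ?; rewrite RintegralD//; exact: bounded_measurable_integrable. Qed.

Lemma meanB f h : bounded_measurable f -> bounded_measurable h ->
  \int[P]_x (f x - h x) = \int[P]_x f x - \int[P]_x h x.
Proof. by move=> ? ?; rewrite RintegralB//; exact: bounded_measurable_integrable. Qed.

Lemma meanZ (a : R) f : bounded_measurable f ->
  \int[P]_x (a * f x) = a * \int[P]_x f x.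
Proof. by move=> ?; rewrite RintegralZl//; exact: bounded_measurable_integrable. Qed.

Lemma mean_sum (I : Type) (s : seq I) (f : I -> T -> R) :
  (forall i, bounded_measurable (f i)) ->
  \int[P]_x (\sum_(i <- s) f i x) = \sum_(i <- s) \int[P]_x f i x.
Proof.
move=> bf; elim: s => [|i s IH].
  by under eq_Rintegral do rewrite big_nil; rewrite mean_cst big_nil.
under eq_Rintegral do rewrite big_cons.
by rewrite meanD// ?IH ?big_cons//; exact: bounded_measurable_sum.
Qed.

Lemma le_mean f h : bounded_measurable f -> bounded_measurable h ->
  (forall x, f x <= h x) -> \int[P]_x f x <= \int[P]_x h x.
Proof.
move=> ? ? fh; apply: le_Rintegral => //; exact: bounded_measurable_integrable.
Qed.

Lemma normr_mean_le f (M : R) : bounded_measurable f ->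
  (forall x, `|f x| <= M) -> `|\int[P]_x f x| <= M.
Proof.
move=> bf fM; have fM' x : - M <= f x <= M by rewrite -ler_norml.
rewrite ler_norml; apply/andP; split.
  rewrite -[leLHS]mean_cst; apply: le_mean => //.
    exact: bounded_measurable_cst.
  by move=> x; have /andP[] := fM' x.
rewrite -[leRHS]mean_cst; apply: le_mean => //.
  exact: bounded_measurable_cst.
by move=> x; have /andP[] := fM' x.
Qed.

Lemma EFin_mean f : bounded_measurable f ->
  (\int[P]_x (f x)%:E = (\int[P]_x f x)%:E)%E.
Proof.
move=> bf; rewrite /Rintegral fineK//.
exact/integrable_fin_num/bounded_measurable_integrable.
Qed.

Lemma mean_indic (A : set T) : measurable A ->
  ((\int[P]_x (\1_A x : R))%:E = P A)%E.
Proof.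
move=> mA; rewrite -EFin_mean; last exact: bounded_measurable_indic.
by rewrite integral_indic// setIT.
Qed.

(** Expands [(f - m) ^+ 2 >= 0] at the mean [m]. It later bounds second moments of [nu] from below
    and, applied to a difference, replaces the Cauchy-Schwarz inequality. *)
Lemma mean_sqr_ge f : bounded_measurable f ->
  (\int[P]_x f x) ^+ 2 <= \int[P]_x (f x ^+ 2).
Proof.
move=> bf; set m := \int[P]_x f x.
have : 0 <= \int[P]_x ((f x - m) ^+ 2).
  by rewrite -[X in X <= _](mean_cst 0); apply: le_mean => [||x];
    [exact: bounded_measurable_cst|
     exact/bounded_measurableX/bounded_measurableB/bounded_measurable_cst|
     exact: sqr_ge0].
have -> : (fun x => (f x - m) ^+ 2) = fun x => f x ^+ 2 + (- (2 * m) * f x + m ^+ 2).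
  by apply/funext => x; rewrite sqrrB mulrC -addrA -mulr_natl mulrA mulNr.
have b2 := bounded_measurableX 2 bf.
have bc := bounded_measurable_cst T (m ^+ 2).
have bz := bounded_measurableZ (- (2 * m)) bf.
rewrite meanD//; last exact: bounded_measurableD.
by rewrite meanD// meanZ// mean_cst -/m => ?; lra.
Qed.

End probability_integral.

(** * Extension of linear identities from indicators to bounded functions *)

Definition bounded_functional (R : realType) (d : measure_display)
    (T : measurableType d) (L : (T -> R) -> R) : Prop :=
  (forall a f h, bounded_measurable f -> bounded_measurable h ->
     L (fun x => a * f x + h x) = a * L f + L h) /\
  exists2 C, 0 <= C & forall f M, bounded_measurable f -> 0 <= M ->
     (forall x, `|f x| <= M) -> `|L f| <= C * M.

Section bounded_functional_ext.
Context (R : realType) (d : measure_display) (T : measurableType d).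
Implicit Types L : (T -> R) -> R.

(* The values of [f] in [0, M] are halved by subtracting [M/2] on [f >= M/2],
   a multiple of an indicator, which [L] does not see. *)
Lemma bounded_functional_eq0 L : bounded_functional L ->
  (forall A, measurable A -> L \1_A = 0) ->
  forall f, bounded_measurable f -> L f = 0.
Proof.
move=> [Llin [C C0 LC]] L1.
have halve m : forall f M, bounded_measurable f -> 0 <= M ->
    (forall x, 0 <= f x <= M) -> `|L f| <= C * (M / 2 ^+ m).
  elim: m => [|m IH] f M bf M0 fM.
    rewrite expr0 divr1; apply: LC => // x.
    by have /andP[f0 ?] := fM x; rewrite ger0_norm.
  set A := f @^-1` `[M / 2, +oo[%classic.
  have mA : measurable A.
    by rewrite -[A]setTI; apply: bf.1 => //; exact: measurable_itv.
  have bA := bounded_measurable_indic R mA.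
  have -> : L f = L (fun x => - (M / 2) * \1_A x + f x).
    by rewrite Llin// L1// mulr0 add0r.
  have -> : M / 2 ^+ m.+1 = M / 2 / 2 ^+ m.
    by rewrite exprS invfM mulrA.
  apply: IH.
  - by apply: bounded_measurableD => //; exact: bounded_measurableZ.
  - by rewrite divr_ge0.
  - move=> x; have /andP[f0 fx] := fM x.
    rewrite indicE; case: (boolP (x \in A)) => xA /=.
      move: xA; rewrite inE /A /= in_itv/= andbT => xA.
      by apply/andP; split; lra.
    have {}xA : f x < M / 2.
      rewrite ltNge; apply/negP => Mf; move/negP: xA; apply.
      by rewrite inE /A /= in_itv/= andbT.
    by apply/andP; split; lra.
have pos f M : bounded_measurable f -> 0 <= M ->
    (forall x, 0 <= f x <= M) -> L f = 0.
  move=> bf M0 fM; apply/eqP; rewrite -normr_le0; apply/ler_addgt0Pr => e e0.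
  have CM0 : 0 <= C * M by rewrite mulr_ge0.
  rewrite add0r.
  (* [C * M / e < k <= 2 ^+ k] makes the bound of [halve] at most [e]. *)
  pose k := (Num.truncn (C * M / e)).+1.
  apply: le_trans (halve k f M bf M0 fM) _.
  rewrite mulrA ler_pdivrMr ?exprn_gt0// [leRHS]mulrC -ler_pdivrMr//.
  apply: (@le_trans _ _ k%:R); first by exact: ltW (truncnS_gt _).
  by rewrite -natrX ler_nat ltnW// ltn_expl.
move=> f bf; have [M M0 fM] := bounded_measurable_ge0 bf.
have b1 : bounded_measurable (fun _ : T => M).
  exact: bounded_measurable_cst.
(* [f + M] takes values in [[0, M + M]], so [L] vanishes on it as well as on the constant [M]. *)
have := Llin 1 f (fun=> M) bf b1; rewrite (pos (fun=> M) M)//; last first.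
  by move=> x; rewrite M0 lexx.
rewrite (pos _ (M + M)) ?addr0 ?mul1r//.
- by under eq_fun do rewrite mul1r; exact: bounded_measurableD.
- exact: addr_ge0.
- by move=> x; have := fM x; rewrite ler_norml => /andP[? ?]; apply/andP; split; lra.
Qed.

(** The previous lemma applied to [L1 - L2]. It acts as a monotone class argument: laws are
    prescribed on sets but used on functions. *)
Lemma bounded_functional_ext L1 L2 :
  bounded_functional L1 -> bounded_functional L2 ->
  (forall A, measurable A -> L1 \1_A = L2 \1_A) ->
  forall f, bounded_measurable f -> L1 f = L2 f.
Proof.
move=> [lin1 [C1 C10 bd1]] [lin2 [C2 C20 bd2]] L12 f bf.
apply/eqP; rewrite -subr_eq0; apply/eqP.
apply: (bounded_functional_eq0 (L := fun f => L1 f - L2 f)) => //; last first.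
  by move=> A mA; rewrite L12// subrr.
split=> [a u v bu bv|]; first by rewrite lin1// lin2//; ring.
exists (C1 + C2) => [|u M bu M0 uM]; first exact: addr_ge0.
by rewrite (le_trans (ler_normB _ _))// mulrDl lerD// ?bd1// bd2.
Qed.

End bounded_functional_ext.

Section mean_functionals.
Context (R : realType) (d : measure_display) (T : measurableType d).
Context (P : probability T R).

(** Covers every functional to be extended: [F f w] will be [f (X w)], a random mean of [f], or
    [f w] itself. The bound of [W] becomes the constant [C]. *)
Lemma mean_weighted_functional (d' : measure_display) (U : measurableType d')
    (W : T -> R) (F : (U -> R) -> T -> R) :
  bounded_measurable W ->
  (forall f, bounded_measurable f -> bounded_measurable (F f)) ->
  (forall w a f h, bounded_measurable f -> bounded_measurable h ->
     F (fun x => a * f x + h x) w = a * F f w + F h w) ->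
  (forall w f M, bounded_measurable f -> 0 <= M ->
     (forall x, `|f x| <= M) -> `|F f w| <= M) ->
  bounded_functional (fun f => \int[P]_w (F f w * W w)).
Proof.
move=> bW bF linF FM.
have bFW f : bounded_measurable f -> bounded_measurable (fun w => F f w * W w).
  by move=> bf; apply: bounded_measurableM => //; exact: bF.
split=> [a f h bf bh|].
  have bZ := bounded_measurableZ a (bFW f bf).
  rewrite -meanZ; last exact: bFW.
  rewrite -(meanD P bZ (bFW h bh)).
  by apply: eq_Rintegral => w _; rewrite linF// mulrDl mulrA.
have [C C0 WC] := bounded_measurable_ge0 bW.
exists C => // f M bf M0 fM; apply: normr_mean_le; first exact: bFW.
by move=> w; rewrite normrM mulrC ler_pM// (FM w f M).
Qed.

End mean_functionals.

(** * Integration against a Markov kernel *)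

Section kernel_mean.
Context (R : realType) (d d' : measure_display).
Context (X : measurableType d) (Y : measurableType d').
Context (K : R.-pker X ~> Y).

Definition kernel_law (x : X) : set Y -> \bar R := K x.

HB.instance Definition _ x := isMeasure.Build _ _ _ (kernel_law x)
  (measure0 (K x)) (measure_ge0 (K x)) (@measure_semi_sigma_additive _ _ _ (K x)).
HB.instance Definition _ x :=
  Measure_isProbability.Build _ _ _ (kernel_law x) (prob_kernel x).

(* [K x] carries no canonical structure of probability measure. *)
Lemma kernel_lawE (x : X) (f : Y -> R) :
  \int[K x]_y f y = \int[kernel_law x : probability Y R]_y f y.
Proof. by []. Qed.

Lemma bounded_measurable_kernel (f : Y -> R) :
  bounded_measurable f -> bounded_measurable (fun x => \int[K x]_y f y).
Proof.
move=> bf; have [M M0 fM] := bounded_measurable_ge0 bf.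
have bM : bounded_measurable (fun _ : Y => M) by exact: bounded_measurable_cst.
have bfM := bounded_measurableD bf bM.
split; last by exists M => x; rewrite kernel_lawE; exact: normr_mean_le.
(* [measurable_fun_integral_kernel] is applied to the nonnegative integrand [f + M]; as [K x] has
   mass 1, subtracting [M] afterwards restores the mean of [f]. *)
rewrite (_ : (fun x => _) =
    fun x => fine (\int[K x]_y (f y + M)%:E)%E - M); last first.
  apply/funext => x.
  rewrite -[fine _]/(\int[kernel_law x : probability Y R]_y (f y + M)).
  by rewrite kernel_lawE meanD// mean_cst addrK.
apply: measurable_funB => //; apply: measurableT_comp => //.
apply: (@measurable_fun_integral_kernel _ _ _ _ _ K).
- by move=> U mU; exact: measurable_kernel.
- by move=> y; rewrite lee_fin; have := fM y; rewrite ler_norml => /andP[? _]; lra.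
- by apply/measurable_EFinP; case: bfM.
Qed.

End kernel_mean.

(** * Conditional laws tested against bounded functions *)

Section conditionally_independent_laws.
Context (R : realType) (dO dT : measure_display).
Context (Omega : measurableType dO) (T : measurableType dT).
Context (P : probability Omega R).

(* The mean with respect to a random probability measure. *)
Definition random_mean (L : (T -> R) -> Omega -> R) : Prop :=
  [/\ forall f, bounded_measurable f -> bounded_measurable (L f),
      forall w a f h, bounded_measurable f -> bounded_measurable h ->
        L (fun x => a * f x + h x) w = a * L f w + L h w &
      forall w f M, bounded_measurable f -> 0 <= M ->
        (forall x, `|f x| <= M) -> `|L f w| <= M].

Context (N : nat) (X : 'I_N -> Omega -> T).
Context (mX : forall i, measurable_fun [set: Omega] (X i)).
Context (L : 'I_N -> (T -> R) -> Omega -> R) (mL : forall i, random_mean (L i)).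

(** Indicators are replaced by bounded functions one coordinate at a time: with the other
    coordinates frozen in the weight, both sides are bounded functionals of the remaining
    function. *)
Lemma product_law_bounded_measurable (W : Omega -> R) : bounded_measurable W ->
  (forall B : 'I_N -> set T, (forall i, measurable (B i)) ->
     \int[P]_w ((\prod_(i < N) \1_(B i) (X i w)) * W w) =
     \int[P]_w ((\prod_(i < N) L i \1_(B i) w) * W w)) ->
  forall f : 'I_N -> T -> R, (forall i, bounded_measurable (f i)) ->
     \int[P]_w ((\prod_(i < N) f i (X i w)) * W w) =
     \int[P]_w ((\prod_(i < N) L i (f i) w) * W w).
Proof.
move=> bW law f bf.
have bX i (h : T -> R) : bounded_measurable h ->
    bounded_measurable (fun w => h (X i w)).
  by move=> bh; exact: bounded_measurable_comp.
have bL i (h : T -> R) : bounded_measurable h -> bounded_measurable (L i h).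
  by case: (mL i) => + _ _; exact.
(* Only the coordinates below [m] may differ from indicators; [m = N] is the claim and [m = 0] is
   [law]. *)
suff : forall m f, (forall i, bounded_measurable (f i)) ->
    (forall i : 'I_N, (m <= i)%N -> exists2 B, measurable B & f i = \1_B) ->
    \int[P]_w ((\prod_(i < N) f i (X i w)) * W w) =
    \int[P]_w ((\prod_(i < N) L i (f i) w) * W w).
  by move=> /(_ N f bf); apply => i; rewrite leqNgt ltn_ord.
elim=> [|m IH] {f bf}f bf fB.
  have /choice[B fE] : forall i, exists B, measurable B /\ f i = \1_B.
    by move=> i; have [B ? ?] := fB i (leq0n i); exists B.
  have fE' : f = fun i => \1_(B i) by apply/funext => i; exact: (fE i).2.
  rewrite fE'; apply: law => i; exact: (fE i).1.
have [mN|Nm] := ltnP m N; last first.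
  by apply: IH => // i /(leq_trans Nm); rewrite leqNgt ltn_ord.
pose i0 := Ordinal mN.
pose W1 w := (\prod_(i < N | i != i0) f i (X i w)) * W w.
pose W2 w := (\prod_(i < N | i != i0) L i (f i) w) * W w.
have bW1 : bounded_measurable W1.
  apply: bounded_measurableM => //; apply: bounded_measurable_prod => i _.
  exact: bX.
have bW2 : bounded_measurable W2.
  apply: bounded_measurableM => //; apply: bounded_measurable_prod => i _.
  exact: bL.
have -> : \int[P]_w ((\prod_(i < N) f i (X i w)) * W w) =
          \int[P]_w (f i0 (X i0 w) * W1 w).
  by apply: eq_Rintegral => w _; rewrite (bigD1 i0)//= -mulrA.
have -> : \int[P]_w ((\prod_(i < N) L i (f i) w) * W w) =
          \int[P]_w (L i0 (f i0) w * W2 w).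
  by apply: eq_Rintegral => w _; rewrite (bigD1 i0)//= -mulrA.
case: (mL i0) => Lm Llin Lbd.
apply: (@bounded_functional_ext _ _ _
  (fun u => \int[P]_w (u (X i0 w) * W1 w))
  (fun u => \int[P]_w (L i0 u w * W2 w))) => //.
- apply: (@mean_weighted_functional _ _ _ P _ _ W1 (fun u w => u (X i0 w))) => //.
  exact: bX.
- exact: (mean_weighted_functional P bW2 Lm Llin Lbd).
(* An indicator in coordinate [m] brings [f'] under the induction hypothesis. *)
move=> A mA; pose f' i := if i == i0 then \1_A : T -> R else f i.
have := IH f'.
have -> : (fun w => (\prod_(i < N) f' i (X i w)) * W w) =
          (fun w => \1_A (X i0 w) * W1 w).
  apply/funext => w; rewrite (bigD1 i0)//= {1}/f' eqxx -mulrA /W1.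
  by do 2 congr (_ * _); apply: eq_bigr => i /negbTE ne; rewrite /f' ne.
have -> : (fun w => (\prod_(i < N) L i (f' i) w) * W w) =
          (fun w => L i0 \1_A w * W2 w).
  apply/funext => w; rewrite (bigD1 i0)//= {1}/f' eqxx -mulrA /W2.
  by do 2 congr (_ * _); apply: eq_bigr => i /negbTE ne; rewrite /f' ne.
apply=> i.
  rewrite /f'; case: eqP => _; [exact: bounded_measurable_indic|exact: bf].
rewrite /f'; case: eqP => [_ _|ne mi]; first by exists A.
apply: fB; rewrite ltn_neqAle mi andbT; apply/eqP => mi'.
by apply: ne; apply/val_inj.
Qed.

Lemma prod_indic (B : 'I_N -> set T) (w : Omega) :
  \prod_(i < N) \1_(B i) (X i w) = \1_[set w | forall i, B i (X i w)] w :> R.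
Proof.
rewrite indicE; case: (boolP (w \in _)) => [|nB].
  by rewrite inE /= => Bw; apply: big1 => i _; rewrite indicE mem_set.
have [i nBi] : exists i, ~ B i (X i w).
  by apply/existsNP => Bw; move/negP: nB; apply; rewrite inE.
by rewrite (bigD1 i)//= indicE memNset// mul0r.
Qed.

Lemma measurable_all (B : 'I_N -> set T) : (forall i, measurable (B i)) ->
  measurable [set w | forall i, B i (X i w)].
Proof.
move=> mB; rewrite (_ : [set w | _] = \bigcap_(i : 'I_N) (X i @^-1` B i)).
  apply: fin_bigcap_measurable => // i _.
  by rewrite -[_ @^-1` _]setTI; exact: mX.
by apply/seteqP; split => w /= Bw i; [move=> _|]; exact: Bw.
Qed.

Lemma bounded_measurable_sub (G : set (set Omega)) (W : Omega -> R) :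
  (forall A, G A -> measurable A) ->
  @bounded_measurable R _ (g_sigma_algebraType G) W -> bounded_measurable W.
Proof.
move=> mG [mW bW]; split=> // _ Y mY.
exact: (smallest_sub (@sigma_algebra_measurable _ Omega) mG (mW _ Y mY)).
Qed.

(** Two extensions are combined. With indicators in place of the [f i], the weight passes from
    indicators of sets of the sigma-algebra of [G], where the claim is [cond_indep_law], to [W];
    then the indicators pass to the [f i]. *)
Lemma cond_indep_law_bounded_measurable (G : set (set Omega))
    (m : 'I_N -> Omega -> set T -> \bar R) :
  (forall A, G A -> measurable A) -> cond_indep_law P G X m ->
  (forall i w B, measurable B -> m i w B = (L i \1_B w)%:E) ->
  forall W : Omega -> R, @bounded_measurable R _ (g_sigma_algebraType G) W ->
  forall f : 'I_N -> T -> R, (forall i, bounded_measurable (f i)) ->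
     \int[P]_w ((\prod_(i < N) f i (X i w)) * W w) =
     \int[P]_w ((\prod_(i < N) L i (f i) w) * W w).
Proof.
move=> mG law mE W bW; have bW' := bounded_measurable_sub mG bW.
apply: product_law_bounded_measurable => // B mB.
have bB i : bounded_measurable (\1_(B i) : T -> R).
  exact: bounded_measurable_indic.
have bprodX : bounded_measurable (fun w => \prod_(i < N) \1_(B i) (X i w) : R).
  by apply: bounded_measurable_prod => i _; exact: bounded_measurable_comp.
have bprodL : bounded_measurable (fun w => \prod_(i < N) L i \1_(B i) w : R).
  by apply: bounded_measurable_prod => i _; case: (mL i) => + _ _; exact.
(* Viewing [Omega] with the sigma-algebra generated by [G] lets the extension lemma range over the
   weights measurable for it. *)
pose gO : measurableType _ := g_sigma_algebraType G.
under eq_Rintegral do rewrite mulrC.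
under [RHS]eq_Rintegral do rewrite mulrC.
apply: (@bounded_functional_ext _ _ gO
  (fun V : gO -> R => \int[P]_w (V w * \prod_(i < N) \1_(B i) (X i w)))
  (fun V : gO -> R => \int[P]_w (V w * \prod_(i < N) L i \1_(B i) w))) => //.
- apply: (@mean_weighted_functional _ _ _ P _ gO _ (fun V w => V w)) => //.
  by move=> V; exact: bounded_measurable_sub.
- apply: (@mean_weighted_functional _ _ _ P _ gO _ (fun V w => V w)) => //.
  by move=> V; exact: bounded_measurable_sub.
move=> A mA; have mA' : dO.-measurable (A : set Omega).
  have := smallest_sub (@sigma_algebra_measurable _ Omega) mG mA; exact.
have mall := measurable_all mB.
apply: EFin_inj; transitivity (P (A `&` [set w | forall i, B i (X i w)])).
  rewrite -(mean_indic P (measurableI _ _ mA' mall)).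
  congr (_ %:E); apply: eq_Rintegral => w _.
  by rewrite prod_indic indicI.
rewrite law// integral_mkcond -EFin_mean; last first.
  by apply: bounded_measurableM => //; exact: bounded_measurable_indic.
apply: eq_integral => w _; rewrite patchE indicE.
case: ifPn => _; rewrite ?mul1r ?mul0r// -prodEFin.
by apply: eq_bigr => i _; exact: mE.
Qed.

End conditionally_independent_laws.

(** * First and second moments of an empirical mean *)

Section empirical_mean.
Context (R : realType) (dO dT : measure_display).
Context (Omega : measurableType dO) (T : measurableType dT).
Context (P : probability Omega R) (N : nat) (N_gt0 : (0 < N)%N).
Context (X : 'I_N -> Omega -> T).
Context (mX : forall i, measurable_fun [set: Omega] (X i)).
Context (a : (T -> R) -> Omega -> R).
Context (a1 : forall w, a (fun=> 1) w = 1).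
Context (W : Omega -> R) (bW : bounded_measurable W).
Context (law : forall f : 'I_N -> T -> R, (forall i, bounded_measurable (f i)) ->
  \int[P]_w ((\prod_(i < N) f i (X i w)) * W w) =
  \int[P]_w ((\prod_(i < N) a (f i) w) * W w)).

(** [a h w] stands for the conditional mean of [h] at one particle and [W] for a factor known from
    the past. Constants 1 in all other coordinates isolate particle [i], by [a1]. *)
Lemma mean_particle (h : T -> R) (i : 'I_N) : bounded_measurable h ->
  \int[P]_w (h (X i w) * W w) = \int[P]_w (a h w * W w).
Proof.
move=> bh; have := @law (fun l => if l == i then h else fun=> 1).
have -> : (fun w => (\prod_(l < N) (if l == i then h else fun=> 1) (X l w)) * W w)
    = (fun w => h (X i w) * W w).
  apply/funext => w; rewrite (bigD1 i)//= eqxx big1 ?mulr1// => l /negbTE.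
  by move=> ->.
have -> : (fun w => (\prod_(l < N) a (if l == i then h else fun=> 1) w) * W w)
    = (fun w => a h w * W w).
  apply/funext => w; rewrite (bigD1 i)//= eqxx big1 ?mulr1// => l /negbTE.
  by move=> ->.
by apply=> l; case: eqP => // _; exact: bounded_measurable_cst.
Qed.

Lemma mean_particle_pair (h : T -> R) (i j : 'I_N) :
  bounded_measurable h -> i != j ->
  \int[P]_w (h (X i w) * h (X j w) * W w) = \int[P]_w (a h w ^+ 2 * W w).
Proof.
move=> bh ij.
pose f l := if (l == i) || (l == j) then h else fun=> 1.
have := @law f.
have -> : (fun w => (\prod_(l < N) f l (X l w)) * W w)
    = (fun w => h (X i w) * h (X j w) * W w).
  apply/funext => w; rewrite (bigD1 i)//= (bigD1 j) 1?eq_sym//= /f !eqxx orbT/=.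
  by rewrite big1 ?mulr1// => l /andP[/negbTE -> /negbTE ->].
have -> : (fun w => (\prod_(l < N) a (f l) w) * W w)
    = (fun w => a h w ^+ 2 * W w).
  apply/funext => w; rewrite (bigD1 i)//= (bigD1 j) 1?eq_sym//= /f !eqxx orbT/=.
  by rewrite big1 ?mulr1 ?expr2// => l /andP[/negbTE -> /negbTE ->].
by apply=> l; rewrite /f; case: ifP => // _; exact: bounded_measurable_cst.
Qed.

Let bXW (h : T -> R) i : bounded_measurable h ->
  bounded_measurable (fun w => h (X i w) * W w).
Proof.
by move=> bh; apply: bounded_measurableM => //; exact: bounded_measurable_comp.
Qed.

Let N_neq0 : N%:R != 0 :> R. Proof. by rewrite pnatr_eq0 -lt0n. Qed.

Lemma mean_empirical (h : T -> R) : bounded_measurable h ->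
  \int[P]_w ((N%:R^-1 * \sum_(i < N) h (X i w)) * W w) = \int[P]_w (a h w * W w).
Proof.
move=> bh.
transitivity (\int[P]_w (N%:R^-1 * \sum_(i < N) (h (X i w) * W w))).
  by apply: eq_Rintegral => w _; rewrite -mulrA mulr_suml.
rewrite meanZ; last by apply: bounded_measurable_sum => i; exact: bXW.
rewrite mean_sum => [|i]; last exact: bXW.
rewrite (eq_bigr (fun=> \int[P]_w (a h w * W w))) => [|i _]; last first.
  exact: mean_particle.
by rewrite sumr_const card_ord -[X in _ * X]mulr_natl mulKf.
Qed.

(** Of the products in the expanded square, the [N] diagonal ones give the mean of [h ^+ 2], and the
    [N * (N - 1)] others factor by conditional independence. *)
Lemma mean_empirical_sqr (h : T -> R) : bounded_measurable h ->
  \int[P]_w ((N%:R^-1 * \sum_(i < N) h (X i w)) ^+ 2 * W w) =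
  N%:R^-1 * \int[P]_w ((N%:R^-1 * \sum_(i < N) h (X i w) ^+ 2) * W w) +
  (1 - N%:R^-1) * \int[P]_w (a h w ^+ 2 * W w).
Proof.
move=> bh; set S := \int[P]_w (a h w ^+ 2 * W w).
have bh2 := bounded_measurableX 2 bh.
have -> : (fun w => (N%:R^-1 * \sum_(i < N) h (X i w)) ^+ 2 * W w) =
    fun w => N%:R^-1 ^+ 2 * \sum_(i < N) \sum_(j < N) (h (X i w) * h (X j w) * W w).
  apply/funext => w; rewrite exprMn -mulrA; congr (_ * _).
  rewrite expr2 mulr_suml mulr_suml; apply: eq_bigr => i _.
  by rewrite mulr_sumr mulr_suml.
have bij i j : bounded_measurable (fun w => h (X i w) * h (X j w) * W w).
  by do 2 ?[apply: bounded_measurableM] => //; exact: bounded_measurable_comp.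
have bi i : bounded_measurable (fun w => \sum_(j < N) (h (X i w) * h (X j w) * W w)).
  exact: bounded_measurable_sum.
rewrite meanZ; last exact: bounded_measurable_sum.
rewrite mean_sum// (mean_empirical bh2).
rewrite (eq_bigr (fun i => \int[P]_w (a (fun x => h x ^+ 2) w * W w) + (N%:R - 1) * S)).
  rewrite sumr_const card_ord -[X in _ * X = _]mulr_natl.
  by field.
move=> i _; rewrite mean_sum// (bigD1 i)//=; congr (_ + _).
  rewrite -(mean_particle i bh2); apply: eq_Rintegral => w _.
  by rewrite expr2.
rewrite (eq_bigr (fun=> S)) => [|j ij]; last first.
  by apply: mean_particle_pair => //; rewrite eq_sym.
rewrite sumr_const cardC1 card_ord -[LHS]mulr_natl.
by rewrite -subn1 natrB.
Qed.

End empirical_mean.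

(** * The propagator and the measures [mu k] *)

Section propagator.
Context (R : realType) (n : nat) (E : nat -> ptopologicalType).
Context (mu : forall k, probability (borel (E k)) R).
Context (g : forall k, borel (E k) -> R).
Context (g_bm : forall k, (k < n)%N -> bounded_measurable (@g k)).
Context (K : forall k, R.-pker (borel (E k)) ~> (borel (E k.+1))).
Context (mu_rec : forall k, (k < n)%N ->
  forall f : borel (E k.+1) -> R, bounded_measurable f ->
    \int[mu k.+1]_x f x =
    (\int[mu k]_x (g x * \int[K k x]_y f y)) / (\int[mu k]_x g x)).

Lemma bounded_measurable_qstep k (f : borel (E k.+1) -> R) : (k < n)%N ->
  bounded_measurable f -> bounded_measurable (qstep mu g K f).
Proof.
move=> kn bf; apply: bounded_measurableM; last exact: bounded_measurable_cst.
apply: bounded_measurableM; first exact: g_bm.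
exact: bounded_measurable_kernel.
Qed.

Lemma mean_qstep k (f : borel (E k.+1) -> R) : (k < n)%N ->
  bounded_measurable f ->
  \int[mu k]_x qstep mu g K f x = \int[mu k.+1]_x f x.
Proof.
move=> kn bf; rewrite mu_rec// mulrC -meanZ.
  by apply: eq_Rintegral => x _; rewrite /qstep mulrC.
by apply: bounded_measurableM; [exact: g_bm|exact: bounded_measurable_kernel].
Qed.

(** [qprop] recurses by splitting off the last step; the moment recursion in the generation index
    splits off the first. *)
Lemma qprop_qstep j k (f : borel (E k) -> R) : (j < k)%N ->
  qprop mu g K f j = qstep mu g K (qprop mu g K f j.+1).
Proof.
elim: k f => // k IH f; rewrite ltnS => jk.
rewrite qpropS//; have [jk'|kj] := ltnP j k; first by rewrite IH// qpropS.
have -> : j = k by apply/eqP; rewrite eqn_leq jk kj.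
by rewrite !qprop_id.
Qed.

Lemma bounded_measurable_qprop j k (f : borel (E k) -> R) :
  (j <= k)%N -> (k <= n)%N -> bounded_measurable f ->
  bounded_measurable (qprop mu g K f j).
Proof.
elim: k f => [|k IH] f; first by rewrite leqn0 => /eqP -> _; rewrite qprop_id.
rewrite leq_eqVlt => /orP[/eqP ->|jk] kn bf; first by rewrite qprop_id.
by rewrite qpropS//; apply: IH => //; [exact: ltnW|exact: bounded_measurable_qstep].
Qed.

Lemma mean_qprop j k (f : borel (E k) -> R) :
  (j <= k)%N -> (k <= n)%N -> bounded_measurable f ->
  \int[mu j]_x qprop mu g K f j x = \int[mu k]_x f x.
Proof.
elim: k f => [|k IH] f; first by rewrite leqn0 => /eqP -> _; rewrite qprop_id.
rewrite leq_eqVlt => /orP[/eqP ->|jk] kn bf; first by rewrite qprop_id.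
rewrite qpropS// IH//; last exact: bounded_measurable_qstep.
  exact: mean_qstep.
exact: ltnW.
Qed.

End propagator.

(** * The conditional law of one generation given the past *)

Section particle_law.
Context (R : realType) (n : nat) (E : nat -> ptopologicalType).
Context (mu : forall k, probability (borel (E k)) R).
Context (g : forall k, borel (E k) -> R).
Context (g_bm : forall k, (k < n)%N -> bounded_measurable (@g k)).
Context (g_gt0 : forall k, (k < n)%N -> forall x, 0 < @g k x).
Context (K : forall k, R.-pker (borel (E k)) ~> (borel (E k.+1))).
Context (N : nat) (N_gt0 : (0 < N)%N).
Context (dO : measure_display) (Omega : measurableType dO).
Context (P : probability Omega R).
Context (xi : forall k, 'I_N -> Omega -> borel (E k)).
Context (xihat : forall k, 'I_N -> Omega -> borel (E k)).
Context (xi_system : particle_system mu g K P xi xihat n).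

Let m_xi k i : (k <= n)%N -> measurable_fun [set: Omega] (xi k i).
Proof. by case: xi_system => -[+ _] _ _ _; exact. Qed.

Let m_xihat k i : (k < n)%N -> measurable_fun [set: Omega] (xihat k i).
Proof. by case: xi_system => -[_ +] _ _ _; exact. Qed.

Lemma past_measurable m m' : (m <= n.+1)%N -> (m' <= n)%N ->
  forall A, past xi xihat m m' A -> measurable A.
Proof.
move=> mn m'n A [|] [j [i [B [jm mB ->]]]]; rewrite -[X in measurable X]setTI.
  by apply: m_xi => //; rewrite -ltnS (leq_trans jm).
by apply: m_xihat => //; rewrite (leq_trans jm).
Qed.

Lemma bounded_measurable_past m m' j (i : 'I_N) (h : borel (E j) -> R) :
  (j < m)%N -> bounded_measurable h ->
  @bounded_measurable R _ (g_sigma_algebraType (past xi xihat m m'))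
    (fun w => h (xi j i w)).
Proof.
move=> jm bh; pose G := g_sigma_algebraType (past xi xihat m m').
apply: (@bounded_measurable_comp _ _ _ _ G) => // _ B mB.
by rewrite setTI; apply: sub_sigma_algebra; left; exists j, i, B.
Qed.

Lemma bounded_measurable_pastS m m' (W : Omega -> R) :
  @bounded_measurable R _ (g_sigma_algebraType (past xi xihat m m')) W ->
  @bounded_measurable R _ (g_sigma_algebraType (past xi xihat m m'.+1)) W.
Proof.
apply: (@bounded_measurable_sub _ _
  (g_sigma_algebraType (past xi xihat m m'.+1))) => A GA.
apply: sub_sigma_algebra; case: GA => -[j [i [B [jm mB ->]]]].
  by left; exists j, i, B.
by right; exists j, i, B; split=> //; exact: ltnW.
Qed.

(** The real-valued mean under [selection_law], in the form required by [random_mean]. *)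
Definition selection_mean k (h : borel (E k) -> R) (w : Omega) : R :=
  \sum_(i < N) g (xi k i w) / (\sum_(l < N) g (xi k l w)) * h (xi k i w).

Let sum_g_gt0 k w : (k < n)%N -> 0 < \sum_(l < N) g (xi k l w).
Proof.
move=> kn; rewrite (bigD1 (Ordinal N_gt0))//= ltr_wpDr ?g_gt0//.
by apply: sumr_ge0 => i _; rewrite ltW ?g_gt0.
Qed.

Lemma selection_meanE k (h : borel (E k) -> R) w :
  selection_mean h w =
  (\sum_(i < N) g (xi k i w) * h (xi k i w)) / (\sum_(l < N) g (xi k l w)).
Proof. by rewrite mulr_suml; apply: eq_bigr => i _; rewrite mulrAC. Qed.

Lemma selection_mean_cst1 k w : (k < n)%N ->
  selection_mean (fun _ : borel (E k) => 1) w = 1.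
Proof.
move=> kn; rewrite selection_meanE; under eq_bigr do rewrite mulr1.
by rewrite divff// gt_eqF// sum_g_gt0.
Qed.

Lemma random_mean_selection k : (k < n)%N -> random_mean (@selection_mean k).
Proof.
move=> kn.
have bd w f M : bounded_measurable f -> 0 <= M ->
    (forall x, `|f x| <= M) -> `|@selection_mean k f w| <= M.
  move=> bf M0 fM; rewrite selection_meanE normrM normfV.
  rewrite (ger0_norm (ltW (sum_g_gt0 _ kn))) ler_pdivrMr ?sum_g_gt0//.
  rewrite mulr_sumr (le_trans (ler_norm_sum _ _ _))//; apply: ler_sum => i _.
  by rewrite normrM mulrC ler_pM// ger0_norm// ltW// g_gt0.
split=> [f bf|w a f h bf bh|//].
- have bfX i : bounded_measurable (fun w => f (xi k i w)).
    by apply: bounded_measurable_comp => //; apply: m_xi; exact: ltnW.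
  have bgX i : bounded_measurable (fun w => g (xi k i w)).
    by apply: bounded_measurable_comp; [apply: m_xi; exact: ltnW|exact: g_bm].
  have [M M0 fM] := bounded_measurable_ge0 bf.
  split; last by exists M => w; exact: bd.
  (* The inverse of the positive total weight is written as a power so that [measurable_powR]
     applies. *)
  rewrite (_ : @selection_mean k f = fun w =>
      (\sum_(i < N) g (xi k i w) * f (xi k i w)) *
      (\sum_(i < N) g (xi k i w)) `^ (-1)); last first.
    apply/funext => w; rewrite selection_meanE powR_inv1//.
    by rewrite ltW// sum_g_gt0.
  apply: measurable_funM.
    apply: measurable_sum => i.
    by apply: measurable_funM; [case: (bgX i)|case: (bfX i)].
  apply: (measurableT_comp (measurable_powR _)).
  by apply: measurable_sum => i; case: (bgX i).
- rewrite !selection_meanE mulrA -mulrDl; congr (_ / _).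
  rewrite mulr_sumr -big_split/=; apply: eq_bigr => i _; ring.
Qed.

Lemma random_mean_mutation k (i : 'I_N) : (k < n)%N ->
  random_mean (fun (h : borel (E k.+1) -> R) w => \int[K k (xihat k i w)]_y h y).
Proof.
move=> kn; split=> [f bf|w a f h bf bh|w f M bf M0 fM].
- apply: (bounded_measurable_comp (f := fun x => \int[K k x]_y f y) (m_xihat i kn)).
  exact: bounded_measurable_kernel.
- rewrite !kernel_lawE meanD ?meanZ//; exact: bounded_measurableZ.
- by rewrite kernel_lawE; exact: normr_mean_le.
Qed.

(* Integrating out the selected particles [xihat k], the particles [xi k.+1]
   are i.i.d. given the past of [xi k]. *)
Lemma particle_law k (W : Omega -> R) (f : 'I_N -> borel (E k.+1) -> R) :
  (k < n)%N ->
  @bounded_measurable R _ (g_sigma_algebraType (past xi xihat k.+1 k)) W ->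
  (forall i, bounded_measurable (f i)) ->
  \int[P]_w ((\prod_(i < N) f i (xi k.+1 i w)) * W w) =
  \int[P]_w
    ((\prod_(i < N) selection_mean (fun x => \int[K k x]_y f i y) w) * W w).
Proof.
move=> kn bW bf; case: xi_system => _ _ sel mut.
(* Mutation comes first, given the past that includes [xihat k]; it leaves functions of [xihat k],
   which selection then averages given the smaller past. *)
rewrite (cond_indep_law_bounded_measurable _ _ _ (mut k kn)
  (L := fun i h w => \int[K k (xihat k i w)]_y h y))//.
- rewrite (cond_indep_law_bounded_measurable _ _ _ (sel k kn)
    (L := fun _ h w => selection_mean h w) _ bW
    (f := fun i x => \int[K k x]_y f i y))//.
  + by move=> i; exact: m_xihat.
  + by move=> i; exact: random_mean_selection.
  + exact: (past_measurable (leqW kn) (ltnW kn)).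
  + move=> i w B mB; rewrite /selection_law /selection_mean -sumEFin.
    by apply: eq_bigr => l _; rewrite diracE indicE EFinM.
  + by move=> i; exact: bounded_measurable_kernel.
- by move=> i; exact: m_xi.
- by move=> i; exact: random_mean_mutation.
- exact: (past_measurable (leqW kn) kn).
- move=> i w B mB.
  by rewrite kernel_lawE (mean_indic (kernel_law (K k) _)).
- exact: bounded_measurable_pastS.
Qed.

Lemma mean_eta_succ k (W : Omega -> R) (h : borel (E k.+1) -> R) :
  (k < n)%N ->
  @bounded_measurable R _ (g_sigma_algebraType (past xi xihat k.+1 k)) W ->
  bounded_measurable h ->
  \int[P]_w (eta xi w h * W w) =
  \int[P]_w (selection_mean (fun x => \int[K k x]_y h y) w * W w).
Proof.
move=> kn bW bh; apply: (mean_empirical N_gt0 (X := xi k.+1) (fun i => m_xi i kn)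
  (a := fun f => selection_mean (fun x => \int[K k x]_y f y))) => //.
- move=> w; rewrite -[RHS](selection_mean_cst1 w kn); congr selection_mean.
  by apply/funext => x; rewrite kernel_lawE mean_cst.
- exact: bounded_measurable_sub (past_measurable (leqW kn) (ltnW kn)) bW.
- by move=> f bf; exact: particle_law.
Qed.

Lemma mean_eta_sqr_succ k (W : Omega -> R) (h : borel (E k.+1) -> R) :
  (k < n)%N ->
  @bounded_measurable R _ (g_sigma_algebraType (past xi xihat k.+1 k)) W ->
  bounded_measurable h ->
  \int[P]_w (eta xi w h ^+ 2 * W w) =
  N%:R^-1 * \int[P]_w (eta xi w (fun x => h x ^+ 2) * W w) +
  (1 - N%:R^-1) *
    \int[P]_w (selection_mean (fun x => \int[K k x]_y h y) w ^+ 2 * W w).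
Proof.
move=> kn bW bh; apply: (mean_empirical_sqr N_gt0 (X := xi k.+1) (fun i => m_xi i kn)
  (a := fun f => selection_mean (fun x => \int[K k x]_y f y))) => //.
- move=> w; rewrite -[RHS](selection_mean_cst1 w kn); congr selection_mean.
  by apply/funext => x; rewrite kernel_lawE mean_cst.
- exact: bounded_measurable_sub (past_measurable (leqW kn) (ltnW kn)) bW.
- by move=> f bf; exact: particle_law.
Qed.

(** The initial particles fit the conditional scheme with the constant random mean under [mu 0]; the
    factor 1 is the trivial weight. *)
Let law0 (f : 'I_N -> borel (E 0) -> R) : (forall i, bounded_measurable (f i)) ->
  \int[P]_w ((\prod_(i < N) f i (xi 0 i w)) * 1) =
  \int[P]_w ((\prod_(i < N) \int[mu 0]_x f i x) * 1).
Proof.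
case: xi_system => _ init _ _.
apply: (product_law_bounded_measurable _
  (L := fun _ h _ => \int[mu 0]_x h x)) => //.
- by move=> i; exact: m_xi.
- move=> _; split=> [h bh|_ a u v bu bv|_ h M bh M0 hM].
  + exact: bounded_measurable_cst.
  + by rewrite meanD ?meanZ//; exact: bounded_measurableZ.
  + exact: normr_mean_le.
- exact: bounded_measurable_cst.
- move=> B mB; apply: EFin_inj.
  have -> : (fun w => \prod_(i < N) \1_(B i) (xi 0 i w) * 1) =
      \1_[set w | forall i, B i (xi 0 i w)] :> (Omega -> R).
    by apply/funext => w; rewrite mulr1 prod_indic.
  rewrite mean_indic; last by apply: measurable_all => // i; exact: m_xi.
  rewrite init// mean_cst mulr1 -prodEFin; apply: eq_bigr => i _.
  by rewrite (mean_indic (mu 0)).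
Qed.

Lemma mean_eta0 (h : borel (E 0) -> R) : bounded_measurable h ->
  \int[P]_w eta xi w h = \int[mu 0]_x h x.
Proof.
move=> bh; have := mean_empirical N_gt0 (fun i => m_xi i (leq0n n))
  (a := fun f _ => \int[mu 0]_x f x) (fun=> mean_cst (mu 0) 1)
  (bounded_measurable_cst Omega 1) law0 bh.
under eq_Rintegral do rewrite mulr1.
by move=> ->; rewrite mulr1 mean_cst.
Qed.

Lemma mean_eta_sqr0 (h : borel (E 0) -> R) : bounded_measurable h ->
  \int[P]_w (eta xi w h ^+ 2) =
  N%:R^-1 * \int[mu 0]_x (h x ^+ 2) +
  (1 - N%:R^-1) * (\int[mu 0]_x h x) ^+ 2.
Proof.
move=> bh; rewrite -mean_eta0; last exact: bounded_measurableX.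
have := mean_empirical_sqr N_gt0 (fun i => m_xi i (leq0n n))
  (a := fun f _ => \int[mu 0]_x f x) (fun=> mean_cst (mu 0) 1)
  (bounded_measurable_cst Omega 1) law0 bh.
under eq_Rintegral do rewrite mulr1.
move=> ->; rewrite mulr1 mean_cst; congr (_ * _ + _).
by apply: eq_Rintegral => w _; rewrite mulr1.
Qed.

End particle_law.

(** * Moments of the weighted empirical measure *)

Section mean_square_error.
Context (R : realType) (n : nat) (E : nat -> ptopologicalType).
Context (mu : forall k, probability (borel (E k)) R).
Context (g : forall k, borel (E k) -> R).
Context (g_bm : forall k, (k < n)%N -> bounded_measurable (@g k)).
Context (g_gt0 : forall k, (k < n)%N -> forall x, 0 < @g k x).
Context (K : forall k, R.-pker (borel (E k)) ~> (borel (E k.+1))).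
Context (mu_rec : forall k, (k < n)%N ->
  forall f : borel (E k.+1) -> R, bounded_measurable f ->
    \int[mu k.+1]_x f x =
    (\int[mu k]_x (g x * \int[K k x]_y f y)) / (\int[mu k]_x g x)).
Context (N : nat) (N_gt0 : (0 < N)%N).
Context (dO : measure_display) (Omega : measurableType dO).
Context (P : probability Omega R).
Context (xi : forall k, 'I_N -> Omega -> borel (E k)).
Context (xihat : forall k, 'I_N -> Omega -> borel (E k)).
Context (xi_system : particle_system mu g K P xi xihat n).

Local Notation q := (qstep mu g K).
Local Notation phi := (phi mu g K xi).
Local Notation nu := (nu mu g K xi).
Local Notation one k := (fun _ : borel (E k) => 1 : R).

Let N_neq0 : N%:R != 0 :> R. Proof. by rewrite pnatr_eq0 -lt0n. Qed.

Let bm_one k : bounded_measurable (one k).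
Proof. exact: bounded_measurable_cst. Qed.

Lemma eta_cst1 k w : eta xi w (one k) = 1.
Proof. by rewrite /eta sumr_const card_ord mulVf. Qed.

Lemma phi0 w : phi 0 w = 1. Proof. by rewrite /Defs.phi big_ord0. Qed.

Lemma phiS k w : phi k.+1 w = nu w (q (one k.+1)).
Proof. by rewrite /Defs.phi big_ord_recr. Qed.

Lemma nu_cst1 k w : nu w (one k) = phi k w.
Proof. by rewrite /Defs.nu eta_cst1 mulr1. Qed.

Lemma nuZ k w (a : R) (f : borel (E k) -> R) :
  nu w (fun x => a * f x) = a * nu w f.
Proof. by rewrite /Defs.nu /eta -mulr_sumr; ring. Qed.

Lemma phi_increment k w : phi k.+1 w - phi k w = nu w (fun x => q (one k.+1) x - 1).
Proof.
rewrite phiS -nu_cst1 /Defs.nu -mulrBr; congr (_ * _).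
by rewrite /eta -mulrBr -sumrB.
Qed.

(** The factors of [phi j] involve only generations below [j]. Hence [phi k.+1] is already known
    from the particles up to [xi k]. *)
Lemma bounded_measurable_phi_past j m m' : (j <= m)%N -> (j <= n)%N ->
  @bounded_measurable R _ (g_sigma_algebraType (past xi xihat m m')) (phi j).
Proof.
move=> jm jn; apply: (@bounded_measurable_prod _ _
  (g_sigma_algebraType (past xi xihat m m'))) => i _.
apply: (@bounded_measurableZ _ _ (g_sigma_algebraType (past xi xihat m m'))).
apply: (@bounded_measurable_sum _ _
  (g_sigma_algebraType (past xi xihat m m'))) => l.
have bq : bounded_measurable (q (one i.+1)).
  by apply: (bounded_measurable_qstep mu g_bm K) => //; exact: leq_trans (ltn_ord i) jn.
by apply: (bounded_measurable_past _ _ _ _ _ bq); exact: leq_trans (ltn_ord i) jm.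
Qed.

Lemma bounded_measurable_phi j : (j <= n)%N -> bounded_measurable (phi j).
Proof.
move=> jn; apply: (bounded_measurable_sub
  (past_measurable xi_system (leqW jn) (leq0n n))).
exact: bounded_measurable_phi_past.
Qed.

Lemma bounded_measurable_eta k (f : borel (E k) -> R) : (k <= n)%N ->
  bounded_measurable f -> bounded_measurable (fun w => eta xi w f).
Proof.
move=> kn bf; apply: bounded_measurableZ; apply: bounded_measurable_sum => i.
apply: bounded_measurable_comp => //.
by case: xi_system => -[+ _] _ _ _; exact.
Qed.

Lemma bounded_measurable_nu k (f : borel (E k) -> R) : (k <= n)%N ->
  bounded_measurable f -> bounded_measurable (fun w => nu w f).
Proof.
move=> kn bf; apply: bounded_measurableM.
  exact: bounded_measurable_phi.
exact: bounded_measurable_eta.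
Qed.

(** The last factor of [phi k.+1] cancels the random normalisation of the selection. This makes the
    recursion linear for [nu], although it is not for [eta]. *)
Lemma phi_selection_mean k w (f : borel (E k.+1) -> R) : (k < n)%N ->
  phi k.+1 w * selection_mean g xi (fun x => \int[K k x]_y f y) w = nu w (q f).
Proof.
move=> kn; rewrite phiS selection_meanE /Defs.nu -mulrA; congr (_ * _).
have S0 : \sum_(l < N) g (xi k l w) != 0.
  rewrite gt_eqF// (bigD1 (Ordinal N_gt0))//= ltr_wpDr ?g_gt0//.
  by apply: sumr_ge0 => i _; rewrite ltW ?g_gt0.
have -> : eta xi w (q (one k.+1)) =
    N%:R^-1 * ((\sum_(l < N) g (xi k l w)) / (\int[mu k]_x g x)).
  rewrite /eta mulr_suml; congr (_ * _); apply: eq_bigr => i _.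
  by rewrite /qstep kernel_lawE mean_cst mulr1.
rewrite /eta -mulrA; congr (_ * _); rewrite mulrC mulrA.
by rewrite mulfVK// mulr_suml.
Qed.

Lemma mean_phi_nu_succ j k (f : borel (E k.+1) -> R) :
  (k < n)%N -> (j <= k.+1)%N -> bounded_measurable f ->
  \int[P]_w (phi j w * nu w f) = \int[P]_w (phi j w * nu w (q f)).
Proof.
move=> kn jk bf.
transitivity (\int[P]_w (eta xi w f * (phi j w * phi k.+1 w))).
  by apply: eq_Rintegral => w _; rewrite /Defs.nu; ring.
rewrite (mean_eta_succ g_bm g_gt0 N_gt0 xi_system kn)//; last first.
  apply: (@bounded_measurableM _ _ (g_sigma_algebraType (past xi xihat k.+1 k)));
    apply: bounded_measurable_phi_past => //.
  exact: leq_trans jk kn.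
apply: eq_Rintegral => w _.
by rewrite -phi_selection_mean//; ring.
Qed.

(** The past factor is [phi k.+1 ^+ 2]. In the diagonal term one copy is absorbed into [nu] and the
    other remains; in the off-diagonal term both are absorbed. *)
Lemma mean_nu_sqr_succ k (f : borel (E k.+1) -> R) :
  (k < n)%N -> bounded_measurable f ->
  \int[P]_w (nu w f ^+ 2) =
  N%:R^-1 * \int[P]_w (phi k.+1 w * nu w (fun x => f x ^+ 2)) +
  (1 - N%:R^-1) * \int[P]_w (nu w (q f) ^+ 2).
Proof.
move=> kn bf.
transitivity (\int[P]_w (eta xi w f ^+ 2 * (phi k.+1 w ^+ 2))).
  by apply: eq_Rintegral => w _; rewrite /Defs.nu; ring.
rewrite (mean_eta_sqr_succ g_bm g_gt0 N_gt0 xi_system kn)//; last first.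
  apply: (@bounded_measurableX _ _ (g_sigma_algebraType (past xi xihat k.+1 k))).
  exact: bounded_measurable_phi_past.
congr (_ * _ + _ * _); apply: eq_Rintegral => w _.
  by rewrite /Defs.nu; ring.
by rewrite -phi_selection_mean//; ring.
Qed.

(** Iterates the martingale step down to generation [i]. The case [j = i.+1] is what later exposes
    the increments of [phi]. *)
Lemma mean_phi_nu_qprop i j k (f : borel (E k) -> R) :
  (j <= i.+1)%N -> (i <= k)%N -> (k <= n)%N -> bounded_measurable f ->
  \int[P]_w (phi j w * nu w f) =
  \int[P]_w (phi j w * nu w (qprop mu g K f i)).
Proof.
move=> ji; elim: k f => [|k IH] f.
  by rewrite leqn0 => /eqP -> _; rewrite qprop_id.
rewrite leq_eqVlt => /orP[/eqP ->|ik] kn bf; first by rewrite qprop_id.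
rewrite mean_phi_nu_succ//; last exact: leq_trans ji ik.
rewrite qpropS// IH//; last exact: (bounded_measurable_qstep mu g_bm K).
exact: ltnW.
Qed.

(** The martingale property carries [f] back to generation 0, where the particles have law [mu 0];
    then [mean_qprop] returns to [mu k]. *)
Lemma mean_nu k (f : borel (E k) -> R) : (k <= n)%N -> bounded_measurable f ->
  \int[P]_w nu w f = \int[mu k]_x f x.
Proof.
move=> kn bf.
transitivity (\int[P]_w (phi 0 w * nu w f)).
  by apply: eq_Rintegral => w _; rewrite phi0 mul1r.
rewrite (@mean_phi_nu_qprop 0)//.
transitivity (\int[P]_w eta xi w (qprop mu g K f 0)).
  by apply: eq_Rintegral => w _; rewrite /Defs.nu phi0 !mul1r.
have b0 := bounded_measurable_qprop mu g_bm K (leq0n k) kn bf.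
rewrite (mean_eta0 N_gt0 xi_system b0).
exact: (mean_qprop g_bm mu_rec).
Qed.

Lemma mean_phi_nu k (f : borel (E k) -> R) : (k <= n)%N -> bounded_measurable f ->
  \int[P]_w (phi k w * nu w f) = \int[mu k]_x f x +
  \sum_(j < k) \int[P]_w (nu w (fun x => q (one j.+1) x - 1) *
                          nu w (qprop mu g K f j)).
Proof.
move=> kn bf.
suff H m : (m <= k)%N -> \int[P]_w (phi m w * nu w f) = \int[mu k]_x f x +
    \sum_(j < m) \int[P]_w (nu w (fun x => q (one j.+1) x - 1) *
                            nu w (qprop mu g K f j)) by exact: H.
elim: m => [_|m IH mk].
  rewrite big_ord0 addr0 -mean_nu//.
  by apply: eq_Rintegral => w _; rewrite phi0 mul1r.
rewrite big_ord_recr/= addrA -IH; last exact: ltnW.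
have mn : (m < n)%N by exact: leq_trans mk kn.
have bq := bounded_measurable_qprop mu g_bm K (ltnW mk) kn bf.
have bnu := bounded_measurable_nu (ltnW mn) bq.
have bph j : (j <= n)%N ->
    bounded_measurable (fun w => phi j w * nu w (qprop mu g K f m)).
  by move=> jn; apply: bounded_measurableM => //; exact: bounded_measurable_phi.
(* Both weights, [phi m.+1] and [phi m], are paired with the same function at generation [m], so
   that their difference yields the next term of the telescoping sum. *)
rewrite (@mean_phi_nu_qprop m m.+1)//; last exact: ltnW.
rewrite (@mean_phi_nu_qprop m m)//; last exact: ltnW.
apply/eqP; rewrite addrC -subr_eq -(meanB P (bph _ mn) (bph _ (ltnW mn))).
by apply/eqP/eq_Rintegral => w _; rewrite -phi_increment mulrBl.
Qed.

Lemma mean_nu_sqr k (f : borel (E k) -> R) : (k <= n)%N -> bounded_measurable f ->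
  N%:R * (\int[P]_w (nu w f ^+ 2) - (\int[mu k]_x f x) ^+ 2) =
  \sum_(j < k.+1) \int[P]_w (phi j w * nu w (fun x => qprop mu g K f j x ^+ 2)) -
  \sum_(j < k) \int[P]_w (nu w (qprop mu g K f j) ^+ 2) - (\int[mu k]_x f x) ^+ 2.
Proof.
move=> kn bf; set M := \int[mu k]_x f x.
(* The claim is generalised to each generation [m]; the functions [qprop f m] share the mean [M]. On
   passing to [m.+1], [mean_nu_sqr_succ] times [N] adds the diagonal mean and removes one copy of
   the previous second moment. *)
suff H m : (m <= k)%N ->
    N%:R * (\int[P]_w (nu w (qprop mu g K f m) ^+ 2) - M ^+ 2) =
    \sum_(j < m.+1) \int[P]_w (phi j w * nu w (fun x => qprop mu g K f j x ^+ 2)) -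
    \sum_(j < m) \int[P]_w (nu w (qprop mu g K f j) ^+ 2) - M ^+ 2.
  by rewrite -H// qprop_id.
elim: m => [_|m IH mk].
  have b0 := bounded_measurable_qprop mu g_bm K (leq0n k) kn bf.
  rewrite big_ord1 big_ord0 subr0.
  have -> : (fun w => nu w (qprop mu g K f 0) ^+ 2) =
      fun w => eta xi w (qprop mu g K f 0) ^+ 2.
    by apply/funext => w; rewrite /Defs.nu phi0 mul1r.
  rewrite (mean_eta_sqr0 N_gt0 xi_system b0).
  have -> : (fun w => phi 0 w * nu w (fun x => qprop mu g K f 0 x ^+ 2)) =
      fun w => nu w (fun x => qprop mu g K f 0 x ^+ 2).
    by apply/funext => w; rewrite phi0 mul1r.
  rewrite mean_nu//; last exact: bounded_measurableX.
  by rewrite (mean_qprop g_bm mu_rec)// -/M; field.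
have mn : (m < n)%N by exact: leq_trans mk kn.
have bq := bounded_measurable_qprop mu g_bm K mk kn bf.
rewrite big_ord_recr/= [X in _ - X - _]big_ord_recr/= mean_nu_sqr_succ//.
rewrite -qprop_qstep//.
have := IH (ltnW mk); set S1 := \sum_(j < m.+1) _; set S2 := \sum_(j < m) _.
move=> IH'; have -> : S1 = N%:R *
   (\int[P]_w (nu w (qprop mu g K f m) ^+ 2) - M ^+ 2) + S2 + M ^+ 2.
  by rewrite IH'; ring.
by field.
Qed.

(** By [mean_nu] the error has mean zero, so its mean square is a variance. *)
Lemma mse_sqr k (f : borel (E k) -> R) : (k <= n)%N -> bounded_measurable f ->
  (mse mu g K P xi f =
   (\int[P]_w (nu w f ^+ 2) - (\int[mu k]_x f x) ^+ 2)%:E)%E.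
Proof.
move=> kn bf; set M := \int[mu k]_x f x.
have bnu := bounded_measurable_nu kn bf.
have bnu2 := bounded_measurableX 2 bnu.
have bM := bounded_measurable_cst Omega M.
rewrite /mse unlock/=.
have -> : (fun w => (`|nu w f - M| ^+ 2)%:E) = fun w => ((nu w f - M) ^+ 2)%:E.
  by apply/funext => w; rewrite real_normK// num_real.
rewrite EFin_mean; last exact/bounded_measurableX/bounded_measurableB.
congr (_%:E).
have -> : (fun w => (nu w f - M) ^+ 2) =
    fun w => nu w f ^+ 2 + (- (2 * M) * nu w f + M ^+ 2).
  by apply/funext => w; ring.
have bz := bounded_measurableZ (- (2 * M)) bnu.
have bM2 := bounded_measurable_cst Omega (M ^+ 2).
rewrite meanD//; last exact: bounded_measurableD.
rewrite meanD// meanZ// mean_cst mean_nu// -/M; ring.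
Qed.

(** By [mean_nu], this is the covariance of the random variables [nu w A] and [nu w B]. *)
Definition nu_covariance k (A B : borel (E k) -> R) : R :=
  \int[P]_w (nu w A * nu w B) - (\int[mu k]_x A x) * \int[mu k]_x B x.

(** Terms with [j < k] become covariances after writing [phi j] as [nu] of the constant 1; the last
    term, expanded by [mean_phi_nu], leaves the mean of [f ^+ 2] and covariances with the
    increments. *)
Lemma mse_le_nu_covariances k (f : borel (E k) -> R) :
  (k <= n)%N -> bounded_measurable f ->
  N%:R * (\int[P]_w (nu w f ^+ 2) - (\int[mu k]_x f x) ^+ 2) <=
  sumVar mu g K f +
  \sum_(j < k)
    (nu_covariance (one j) (fun x => qprop mu g K f j x ^+ 2) +
     nu_covariance (fun x => q (one j.+1) x - 1)
                (qprop mu g K (fun x => f x ^+ 2) j)).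
Proof.
move=> kn bf; rewrite mean_nu_sqr//; set M := \int[mu k]_x f x.
have bq j : (j <= k)%N -> bounded_measurable (qprop mu g K f j).
  by move=> jk; exact: (bounded_measurable_qprop mu g_bm K).
rewrite big_ord_recr/= qprop_id mean_phi_nu//; last exact: bounded_measurableX.
have -> : sumVar mu g K f = \sum_(j < k)
    (\int[mu j]_x (qprop mu g K f j x ^+ 2) - M ^+ 2) +
    \int[mu k]_x (f x ^+ 2) - M ^+ 2.
  rewrite /sumVar big_ord_recr/= qprop_id -addrA; congr (_ + _).
  apply: eq_bigr => j _; rewrite /Var (mean_qprop g_bm mu_rec)//.
  exact: ltnW.
(* The only inequality of the argument: the subtracted second moments are at least the squared means
   [M ^+ 2] that occur in the variances. *)
have z_ge : \sum_(j < k) M ^+ 2 <=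
    \sum_(j < k) \int[P]_w (nu w (qprop mu g K f j) ^+ 2).
  apply: ler_sum => j _.
  have jk := ltnW (ltn_ord j); have jn := leq_trans jk kn.
  rewrite /M -(mean_qprop g_bm mu_rec jk kn bf) -(mean_nu jn (bq j jk)).
  by apply: mean_sqr_ge; apply: bounded_measurable_nu => //; exact: bq.
have -> : \sum_(j < k)
    (nu_covariance (one j) (fun x => qprop mu g K f j x ^+ 2) +
     nu_covariance (fun x => q (one j.+1) x - 1)
                (qprop mu g K (fun x => f x ^+ 2) j)) =
  \sum_(j < k) \int[P]_w (phi j w * nu w (fun x => qprop mu g K f j x ^+ 2)) -
  \sum_(j < k) \int[mu j]_x (qprop mu g K f j x ^+ 2) +
  \sum_(j < k) \int[P]_w (nu w (fun x => q (one j.+1) x - 1) *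
     nu w (qprop mu g K (fun x => f x ^+ 2) j)).
  rewrite -sumrB -big_split/=; apply: eq_bigr => j _; congr (_ + _).
    rewrite /nu_covariance mean_cst mul1r; congr (_ - _).
    by apply: eq_Rintegral => w _; rewrite nu_cst1.
  (* [q (one j.+1) - 1] has mean zero under [mu j], so this covariance is the mean of the
     product. *)
  have jn : (j < n)%N by exact: leq_trans (ltn_ord j) kn.
  rewrite /nu_covariance meanB//; last exact: (bounded_measurable_qstep mu g_bm K).
  by rewrite (mean_qstep g_bm mu_rec)// !mean_cst subrr mul0r subr0.
rewrite sumrB; move: z_ge.
set a1 := \sum_(j < k) \int[P]_w (phi j w * _).
set a2 := \sum_(j < k) \int[P]_w (nu w _ * _).
set a3 := \sum_(j < k) \int[P]_w (nu w _ ^+ _).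
set a4 := \sum_(j < k) M ^+ 2.
set a5 := \sum_(j < k) \int[mu j]_x _.
by move=> ?; lra.
Qed.

Lemma nu_covarianceZ k (a b : R) (A B : borel (E k) -> R) : (k <= n)%N ->
  bounded_measurable A -> bounded_measurable B ->
  nu_covariance (fun x => a * A x) (fun x => b * B x) = a * b * nu_covariance A B.
Proof.
move=> kn bA bB; rewrite /nu_covariance !meanZ//.
have -> : (fun w => nu w (fun x => a * A x) * nu w (fun x => b * B x)) =
    fun w => a * b * (nu w A * nu w B).
  by apply/funext => w; rewrite !nuZ; ring.
rewrite meanZ; first by ring.
by apply: bounded_measurableM; exact: bounded_measurable_nu.
Qed.

(** The variance of [nu w A - nu w B] is nonnegative, so twice the covariance is at most the sum of
    the two mean square errors. *)
Lemma nu_covariance_le k (e : R) (A B : borel (E k) -> R) : (k <= n)%N ->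
  bounded_measurable A -> bounded_measurable B ->
  (mse mu g K P xi A <= e%:E)%E -> (mse mu g K P xi B <= e%:E)%E ->
  nu_covariance A B <= e.
Proof.
move=> kn bA bB; rewrite !mse_sqr// !lee_fin /nu_covariance.
have bnA := bounded_measurable_nu kn bA.
have bnB := bounded_measurable_nu kn bB.
have bA2 := bounded_measurableX 2 bnA; have bB2 := bounded_measurableX 2 bnB.
have bAB := bounded_measurableZ (-2) (bounded_measurableM bnA bnB).
have := mean_sqr_ge P (bounded_measurableB bnA bnB).
rewrite meanB// !mean_nu//.
have -> : (fun w => (nu w A - nu w B) ^+ 2) =
    fun w => nu w A ^+ 2 + (nu w B ^+ 2 + -2 * (nu w A * nu w B)).
  by apply/funext => w; ring.
rewrite meanD//; last exact: bounded_measurableD.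
rewrite meanD// meanZ; last exact: bounded_measurableM.
by move=> ? ? ?; lra.
Qed.

(** * Estimates in terms of the norms *)

Context (nrm : forall k, (borel (E k) -> R) -> R).
Context (nrm_norm : forall k, (k <= n)%N -> is_norm (@nrm k)).

Local Notation eps := (eps mu g K P xi nrm).

Let nrm_ge0 k (f : borel (E k) -> R) : (k <= n)%N -> bounded_measurable f ->
  0 <= nrm f.
Proof. by move=> /nrm_norm[+ _ _ _]; exact. Qed.

Lemma mse_le_eps k (f : borel (E k) -> R) : bounded_measurable f ->
  nrm f <= 1 -> (mse mu g K P xi f <= eps k)%E.
Proof. by move=> bf f1; apply: ereal_sup_ubound; exists f. Qed.

Lemma nrm0 k : (k <= n)%N -> nrm (fun x : borel (E k) => 0) = 0.
Proof.
move=> kn; have [_ _ homo _] := nrm_norm kn.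
by have := homo 0 _ (bm_one k); rewrite normr0 !mul0r.
Qed.

Lemma eps_ge0 k : (k <= n)%N -> (0 <= eps k)%E.
Proof.
move=> kn; have b0 := bounded_measurable_cst (borel (E k)) (0 : R).
apply: le_trans (mse_le_eps b0 _); last by rewrite nrm0// ler01.
rewrite mse_sqr// lee_fin subr_ge0 -mean_nu//.
by apply: mean_sqr_ge; exact: bounded_measurable_nu.
Qed.

(** Both functions are scaled to norm 1, where [nu_covariance_le] applies with [eps k]; vanishing
    norms and an infinite [eps k] are treated apart. *)
Lemma nu_covariance_le_eps k (A B : borel (E k) -> R) : (k <= n)%N ->
  bounded_measurable A -> bounded_measurable B ->
  ((nu_covariance A B)%:E <= (nrm A * nrm B)%:E * eps k)%E.
Proof.
move=> kn bA bB; have [_ nrm_eq0 homo _] := nrm_norm kn.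
have null (C : borel (E k) -> R) : bounded_measurable C -> nrm C = 0 -> C = fun x => 0 * (one k) x.
  by move=> bC /(nrm_eq0 _ bC) ->; apply/funext => x; rewrite mul0r.
(* A function of norm 0 vanishes, and then both sides are 0, also when [eps k] is infinite. *)
have [A0|nA0] := eqVneq (nrm A) 0.
  rewrite A0 mul0r mul0e (null A bA A0).
  have -> : B = fun x => 1 * B x by apply/funext => x; rewrite mul1r.
  by rewrite nu_covarianceZ// !mul0r.
have [B0|nB0] := eqVneq (nrm B) 0.
  rewrite B0 mulr0 mul0e (null B bB B0).
  have -> : A = fun x => 1 * A x by apply/funext => x; rewrite mul1r.
  by rewrite nu_covarianceZ// mulr0 mul0r.
have A_gt0 : 0 < nrm A by rewrite lt_def nA0 nrm_ge0.
have B_gt0 : 0 < nrm B by rewrite lt_def nB0 nrm_ge0.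
(* If [eps k] is infinite, so is the right-hand side, both norms being positive. *)
case e : (eps k) (eps_ge0 kn) => [r| |//] r0; last first.
  by rewrite gt0_muley ?lte_fin ?mulr_gt0// leey.
have unit (C : borel (E k) -> R) : bounded_measurable C -> 0 < nrm C ->
    (mse mu g K P xi (fun x => ((nrm C)^-1 * C x)%R) <= r%:E)%E.
  move=> bC C0; rewrite -e; apply: mse_le_eps; first exact: bounded_measurableZ.
  by rewrite homo// gtr0_norm ?invr_gt0// mulVf// gt_eqF.
rewrite -EFinM lee_fin.
have := nu_covariance_le kn (bounded_measurableZ _ bA) (bounded_measurableZ _ bB)
  (unit A bA A_gt0) (unit B bB B_gt0).
by rewrite nu_covarianceZ// -invfM mulrC ler_pdivrMr ?mulr_gt0// mulrC.
Qed.

Context (c : nat -> nat -> R).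
Context (c_bound : forall j k, (j < k)%N -> (k <= n)%N ->
  forall f : borel (E k) -> R, bounded_measurable f ->
    Num.max
      (nrm (one j) * nrm (fun x => qprop mu g K f j x ^+ 2))
      (Num.max (nrm (qprop mu g K f j) ^+ 2)
               (nrm (qprop mu g K (fun x => f x ^+ 2) j)))
    <= c j k * nrm f ^+ 2).

Local Notation coef j k := (c j k * (2 + nrm (fun x => q (one j.+1) x - 1))).

(** Tests [c_bound] on the constant 1, whose norm is positive because the spaces are pointed and so
    nonempty. *)
Lemma c_ge0 j k : (j < k)%N -> (k <= n)%N -> 0 <= c j k.
Proof.
move=> jk kn; have [_ nrm_eq0 _ _] := nrm_norm kn.
have one_gt0 : 0 < nrm (one k).
  rewrite lt_def nrm_ge0// andbT; apply/eqP => /(nrm_eq0 _ (bm_one k)).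
  by move=> /(congr1 (@^~ point)) /eqP; rewrite oner_eq0.
have := c_bound jk kn (bm_one k); rewrite ge_max => /andP[_].
rewrite ge_max => /andP[+ _] => /(le_trans (sqr_ge0 _)).
by rewrite pmulr_lge0// exprn_gt0.
Qed.

Lemma coef_ge0 j k : (j < k)%N -> (k <= n)%N -> 0 <= coef j k.
Proof.
move=> jk kn; have jn := leq_trans jk kn.
rewrite mulr_ge0 ?c_ge0// addr_ge0// nrm_ge0//; first exact: ltnW.
apply: bounded_measurableB => //; exact: (bounded_measurable_qstep mu g_bm K).
Qed.

Lemma mse_le_sum_eps k (f : borel (E k) -> R) : (k <= n)%N ->
  bounded_measurable f ->
  (N%:R%:E * mse mu g K P xi f <= (sumVar mu g K f)%:E +
     \sum_(j < k) (nrm f ^+ 2 * coef j k)%:E * eps j)%E.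
Proof.
move=> kn bf; rewrite mse_sqr// -EFinM.
apply: (@le_trans _ _ (_)%:E); first by rewrite lee_fin; exact: mse_le_nu_covariances.
rewrite EFinD leeD2l// -sumEFin; apply: lee_sum => j _.
have jk := ltn_ord j; have jn := leq_trans jk kn.
have bf2 := bounded_measurableX 2 bf.
have bq := bounded_measurable_qprop mu g_bm K (ltnW jk) kn bf.
have bq2 := bounded_measurable_qprop mu g_bm K (ltnW jk) kn bf2.
have b1 : bounded_measurable (fun x : borel (E j) => q (one j.+1) x - 1).
  apply: bounded_measurableB => //; exact: (bounded_measurable_qstep mu g_bm K).
have := c_bound jk kn bf; rewrite !ge_max => /and3P[h1 _ h2].
have e0 := eps_ge0 (ltnW jn).
rewrite EFinD; apply: le_trans (leeD
  (nu_covariance_le_eps (ltnW jn) (bm_one j) (bounded_measurableX 2 bq))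
  (nu_covariance_le_eps (ltnW jn) b1 bq2)) _.
rewrite -ge0_muleDl ?lee_fin ?mulr_ge0 ?nrm_ge0//; try exact: ltnW; last first.
  exact: bounded_measurableX.
rewrite -EFinD lee_wpmul2r// lee_fin.
have n1 := nrm_ge0 (ltnW jn) b1.
have c0 := c_ge0 jk kn.
have cf0 : 0 <= c j k * nrm f ^+ 2 by rewrite mulr_ge0// sqr_ge0.
have h3 := ler_wpM2l n1 h2.
(* With [d] the norm of [q 1 - 1], the two covariances contribute [1] and [d] times
   [c j k * nrm f ^+ 2], against [2 + d] in [coef]. *)
apply: le_trans (lerD h1 h3) _; rewrite -subr_ge0.
set d := nrm (fun x => q _ x - 1).
rewrite (_ : _ - _ = c j k * nrm f ^+ 2)//; ring.
Qed.

(** The supremum of [mse_le_sum_eps] over the unit ball. Only indices [j < k] occur on the right,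
    which makes induction on [k] possible. *)
Lemma eps_le k : (k <= n)%N ->
  (N%:R%:E * eps k <= vhat mu g K nrm k + \sum_(j < k) (coef j k)%:E * eps j)%E.
Proof.
move=> kn; rewrite -lee_pdivlMl ?ltr0n//.
apply: ge_ereal_sup => _ [f [bf f1] <-]; rewrite lee_pdivlMl ?ltr0n//.
apply: le_trans (mse_le_sum_eps kn bf) _; apply: leeD.
  by apply: ereal_sup_ubound; exists f.
apply: lee_sum => j _; have jk := ltn_ord j.
rewrite lee_wpmul2r ?eps_ge0//; first exact: ltnW (leq_trans jk kn).
by rewrite lee_fin ler_piMl ?coef_ge0// expr_le1 ?nrm_ge0.
Qed.

Lemma mse_le_epsbar (f : borel (E n) -> R) : bounded_measurable f ->
  (N%:R%:E * mse mu g K P xi f <=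
   (sumVar mu g K f)%:E +
   (nrm f ^+ 2 * chat mu g K nrm c n)%:E * epsbar mu g K P xi nrm n)%E.
Proof.
move=> bf; apply: le_trans (mse_le_sum_eps (leqnn n) bf) _; apply: leeD2l.
(* Nonnegative coefficients allow distribution over the sum even when [epsbar] is infinite. *)
rewrite /chat mulr_sumr -sumEFin ge0_sume_distrl; last first.
  move=> j _; rewrite lee_fin mulr_ge0 ?sqr_ge0// coef_ge0//.
apply: lee_sum => j _; rewrite lee_wpmul2l//.
  by rewrite lee_fin mulr_ge0 ?sqr_ge0// coef_ge0.
rewrite /epsbar.
by rewrite (le_bigmax _ (fun j : 'I_n.+1 => eps j) (widen_ord (leqnSn n) j)).
Qed.

(** An infinite [vbar] makes the bound trivial. Otherwise all [eps k] are finite, and the term with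
    [cbar] can be absorbed. *)
Lemma epsbar_le_vbar : 2 * cbar mu g K nrm c n <= N%:R ->
  (epsbar mu g K P xi nrm n <=
   2%:E * (vbar mu g K nrm n * (N%:R^-1)%:E))%E.
Proof.
move=> cN.
have N0 : (0 : R) < N%:R by rewrite ltr0n.
have vhat_le k : (k <= n)%N -> (vhat mu g K nrm k <= vbar mu g K nrm n)%E.
  move=> kn; rewrite -ltnS in kn.
  exact: (le_bigmax _ (fun j : 'I_n.+1 => vhat mu g K nrm j) (Ordinal kn)).
(* The zero function is admissible in each supremum, which rules out the value [-oo]. *)
have vhatNy k : (k <= n)%N -> (-oo < vhat mu g K nrm k)%E.
  move=> kn; have b0 := bounded_measurable_cst (borel (E k)) (0 : R).
  apply: (@lt_le_trans _ _ (sumVar mu g K (fun _ : borel (E k) => 0))%:E).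
    exact: ltNyr.
  by apply: ereal_sup_ubound; eexists; [split; [exact: b0|rewrite nrm0]|].
case v : (vbar mu g K nrm n) => [r| |]; last first.
- by have := lt_le_trans (vhatNy 0 (leq0n n)) (vhat_le 0 (leq0n n)); rewrite v.
- by rewrite gt0_mulye ?lte_fin ?invr_gt0// gt0_muley ?lte_fin// leey.
(* Strong induction through [eps_le]: its right-hand side consists of [vhat k], which is below
   [+oo], and of earlier [eps j]. *)
have eps_fin k : (k <= n)%N -> eps k \is a fin_num.
  elim/ltn_ind: k => k IH kn; rewrite ge0_fin_numE ?eps_ge0//.
  rewrite -(@lte_pmul2l _ N%:R%:E)//.
  rewrite gt0_muley ?lte_fin//.
  apply: le_lt_trans (eps_le kn) _; apply: lte_add_pinfty.
    by apply: le_lt_trans (vhat_le k kn) _; rewrite v ltry.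
  apply: lte_sum_pinfty => j _.
  have := IH j (ltn_ord j) (ltnW (leq_trans (ltn_ord j) kn)).
  by move=> /fineK <-; rewrite -EFinM ltry.
(* A real counterpart of [epsbar], with starting value 0 in place of [-oo]. *)
pose m := \big[Num.max/0]_(j < n.+1) fine (eps j).
have eps_m k : (k <= n)%N -> (eps k <= m%:E)%E.
  move=> kn; rewrite -(fineK (eps_fin k kn)) lee_fin.
  rewrite -ltnS in kn.
  exact: (le_bigmax _ (fun j : 'I_n.+1 => fine (eps j)) (Ordinal kn)).
have m0 : 0 <= m by rewrite -lee_fin; exact: le_trans (eps_ge0 _) (eps_m 0 _).
have chat_le k : (k <= n)%N -> chat mu g K nrm c k <= cbar mu g K nrm c n.
  move=> kn; rewrite -ltnS in kn.
  exact: (le_bigmax _ (fun j : 'I_n.+1 => chat mu g K nrm c j) (Ordinal kn)).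
have step k : (k <= n)%N -> N%:R * fine (eps k) <= r + cbar mu g K nrm c n * m.
  move=> kn; rewrite -lee_fin EFinM fineK ?eps_fin//.
  apply: le_trans (eps_le kn) _; rewrite EFinD leeD//; first by rewrite -v vhat_le.
  apply: (@le_trans _ _ (\sum_(j < k) (coef j k * m)%:E)%E).
    apply: lee_sum => j _; have jk := ltn_ord j.
    rewrite [leRHS]EFinM lee_wpmul2l ?lee_fin ?coef_ge0//; apply: eps_m.
    exact: ltnW (leq_trans jk kn).
  by rewrite sumEFin lee_fin -mulr_suml ler_wpM2r// chat_le.
have m_le : N%:R * m <= r + cbar mu g K nrm c n * m.
  rewrite -ler_pdivlMl//; apply: bigmax_le => [|j _]; last first.
    by rewrite ler_pdivlMl//; apply: step; rewrite -ltnS.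
  (* The starting value 0 obeys the bound as well, since [step 0] puts a nonnegative quantity below
     the right-hand side. *)
  rewrite mulr_ge0 ?invr_ge0 ?ler0n//; apply: le_trans (step 0 (leq0n n)).
  by rewrite mulr_ge0 ?ler0n// fine_ge0// eps_ge0.
apply: (@le_trans _ _ m%:E).
  by apply: bigmax_le => [|j _]; [rewrite leNye|apply: eps_m; rewrite -ltnS].
rewrite -!EFinM lee_fin mulrA ler_pdivlMr//.
(* [2 * cbar <= N] gives [cbar * m <= N * m / 2], so half of [N * m] is absorbed and
   [N * m <= 2 * r] remains. *)
by move: m_le (ler_wpM2r m0 cN); lra.
Qed.
End mean_square_error.

Theorem theorem3p2 (R : realType) (n : nat) (E : nat -> ptopologicalType)
  (E_polish : forall k, (k <= n)%N -> polish R (E k))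
  (mu : forall k, probability (borel (E k)) R)
  (g : forall k, borel (E k) -> R)
  (g_bm : forall k, (k < n)%N -> bounded_measurable (g k))
  (g_gt0 : forall k, (k < n)%N -> forall x, 0 < g k x)
  (K : forall k, R.-pker (borel (E k)) ~> (borel (E k.+1)))
  (mu_rec : forall k, (k < n)%N ->
     forall f : borel (E k.+1) -> R, bounded_measurable f ->
       \int[mu k.+1]_x f x =
       (\int[mu k]_x (g k x * \int[K k x]_y f y)) / (\int[mu k]_x g k x))
  (N : nat) (N_gt0 : (0 < N)%N)
  (dO : measure_display) (Omega : measurableType dO) (P : probability Omega R)
  (xi : forall k, 'I_N -> Omega -> borel (E k))
  (xihat : forall k, 'I_N -> Omega -> borel (E k))
  (xi_system : particle_system mu g K P xi xihat n)
  (nrm : forall k, (borel (E k) -> R) -> R)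
  (nrm_norm : forall k, (k <= n)%N -> is_norm (nrm k))
  (c : nat -> nat -> R)
  (c_bound : forall j k, (j < k)%N -> (k <= n)%N ->
     forall f : borel (E k) -> R, bounded_measurable f ->
       Num.max
         (nrm j (fun=> 1) * nrm j (fun x => qprop mu g K f j x ^+ 2))
         (Num.max (nrm j (qprop mu g K f j) ^+ 2)
                  (nrm j (qprop mu g K (fun x => f x ^+ 2) j)))
       <= c j k * nrm k f ^+ 2) :
  (forall f : borel (E n) -> R, bounded_measurable f ->
     (N%:R%:E * mse mu g K P xi f <=
      (sumVar mu g K f)%:E +
      (nrm n f ^+ 2 * chat mu g K nrm c n)%:E * epsbar mu g K P xi nrm n)%E) /\
  (2 * cbar mu g K nrm c n <= N%:R ->
     (epsbar mu g K P xi nrm n <=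
      2%:E * (vbar mu g K nrm n * (N%:R^-1)%:E))%E).
Proof.
split=> [f bf|cN].
  exact: (mse_le_epsbar g_bm g_gt0 mu_rec N_gt0 xi_system nrm_norm c_bound bf).
exact: (epsbar_le_vbar g_bm g_gt0 mu_rec N_gt0 xi_system nrm_norm c_bound cN).
Qed.
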